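(* Let $m\ge1$ be an integer and let $(X_k)_{k=-\infty}^{\infty}$ be a strictly stationary sequence of $m$-dependent real random variables with finite variance. Let $S_n:=\sum_{i=1}^n X_i$ and $$\sigma^2:=\operatorname{Var}(X_0)+2\sum_{k=1}^m \operatorname{Cov}(X_0,X_k).$$ Suppose that $\sigma^2=0$. Then $S_n-\mathbb E S_n$ has the same distribution for all $n\ge m$. More precisely, if $(Y_k)_{k=-\infty}^{\infty}$ is a strictly stationary sequence of $(m-1)$-dependent random variables with finite variance and $\mu$ is a constant such that $X_k=Y_k-Y_{k-1}+\mu$ a.s. for every $k\in\mathbb Z$ (such $(Y_k)$ and $\mu$ exist), and if $Y_0'$ is an independent copy of $Y_0$, then for every $n\ge m$, $$S_n-\mathbb E S_n\overset{\mathrm d}{=}Y_0-Y_0'.$$ Hence, if moreover $\operatorname{Var}(X_0)>0$, then $(S_n-\mathbb E S_n)/\operatorname{Var}(S_n)^{1/2}$ converges in distribution as $n\to\infty$, but the limit is normal only if each $Y_k$ is normal.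
   Context: For an integer $m\ge 0$, a strictly stationary sequence $(X_k)_{k=-\infty}^\infty$ of random variables is called $m$-dependent if $(X_k)_{k\le 0}$ is independent of $(X_k)_{k\ge m+1}$ (hence, by stationarity, $(X_k)_{k\le j}$ is independent of $(X_k)_{k\ge j+m+1}$ for every $j\in\mathbb Z$). In particular, a strictly stationary $0$-dependent sequence is an i.i.d. sequence. Strictly stationary means that the joint distribution of the whole sequence is invariant under shifts of the index. Finite variance means $\mathbb E X_k^2<\infty$. The symbol $\overset{\mathrm d}{=}$ denotes equality in distribution. *)

(* Defs.v *)
From HB Require Import structures.
From mathcomp Require Export all_boot all_order all_algebra.
From mathcomp Require Export all_classical all_reals all_analysis.
From mathcomp Require Export measurable_realfun.

Set Implicit Arguments.
Unset Strict Implicit.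
Unset Printing Implicit Defensive.

Import Order.TTheory GRing.Theory Num.Theory.
Import numFieldNormedType.Exports.

Local Open Scope classical_set_scope.
Local Open Scope ring_scope.
Local Open Scope ereal_scope.

Definition sigma_family (I T : Type) (d : measure_display)
    (T' : measurableType d) (D : set I) (f : I -> T -> T') : set (set T) :=
  <<s \bigcup_(i in D) preimage_set_system setT (f i) measurable >>.

Definition independent_classes (d : measure_display) (T : measurableType d)
    (R : realType) (P : probability T R) (F G : set (set T)) : Prop :=
  forall A B, F A -> G B -> P (A `&` B) = P A * P B.

Definition independent_RV (d : measure_display) (T : measurableType d)
    (R : realType) (P : probability T R) (U V : {RV P >-> R}) : Prop :=
  independent_classes P (preimage_set_system setT U measurable)
                        (preimage_set_system setT V measurable).

(* Quantifies only over measurable sets: as functions on all of [set R], the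
   two distributions are unconstrained outside the Borel sets. *)
Definition eq_dist (d d' : measure_display) (T : measurableType d)
    (T' : measurableType d') (R : realType) (P : probability T R)
    (P' : probability T' R) (U : {RV P >-> R}) (V : {RV P' >-> R}) : Prop :=
  forall A : set R, measurable A -> distribution P U A = distribution P' V A.

Section sequences.
Context (d : measure_display) (T : measurableType d) (R : realType).
Variable P : probability T R.
Implicit Type X Y : int -> {RV P >-> R}.

(* [sigma_family setT (fun k x => x k)] is the product (cylinder)
   sigma-algebra on the space [int -> R] of two-sided sequences. *)
Definition strictly_stationary X : Prop :=
  forall (h : int) (A : set (int -> R)),
    sigma_family setT (fun (k : int) (x : int -> R) => x k) A ->
    P [set w | A (fun k : int => X (k + h)%R w)] =
    P [set w | A (fun k : int => X k w)].

Definition m_dependent (m : nat) X : Prop :=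
  independent_classes P (sigma_family [set k : int | (k <= 0)%R] X)
                        (sigma_family [set k : int | (m.+1%:Z <= k)%R] X).

Definition finite_variance X : Prop :=
  forall k : int, 'E_P[fun w => (X k w ^+ 2)%R] < +oo.

Definition asymptotic_variance (m : nat) X : \bar R :=
  'V_P[X 0%R] + 2%:E * \sum_(1 <= k < m.+1) covariance P (X 0%R) (X k%:Z).

Definition partial_sum X (n : nat) : {RV P >-> R} :=
  (\sum_(1 <= i < n.+1) (X i%:Z : {mfun T >-> R}))%R.

Definition centered (U : {RV P >-> R}) : {RV P >-> R} :=
  ((U : {mfun T >-> R}) - cst (fine 'E_P[U]))%R.

(* For 'V_P[U] = 0 this is the zero variable, since 0^-1 = 0. *)
Definition standardized (U : {RV P >-> R}) : {RV P >-> R} :=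
  ((centered U : {mfun T >-> R}) * cst (Num.sqrt (fine 'V_P[U]))^-1)%R.

Definition differences_of (m : nat) X Y (mu : R) : Prop :=
  [/\ strictly_stationary Y, m_dependent m.-1 Y, finite_variance Y &
      forall k : int, {ae P, forall w, X k w = (Y k w - Y (k - 1) w + mu)%R}].

Definition cvg_in_dist (Z : nat -> {RV P >-> R})
    (nu : probability (measurableTypeR R) R) : Prop :=
  forall f : R -> R, continuous f -> (exists M : R, forall x, `|f x| <= M)%R ->
    'E_P[f \o Z n] @[n --> \oo] --> \int[nu]_x (f x)%:E.

End sequences.

(* [normal_prob m 0] is not a point mass in the library (its density is the
   indicator of [0, 1]), whence the condition on [s]. *)
Definition normal_law (R : realType) (nu : set R -> \bar R) : Prop :=
  exists m s : R, (0 < s)%R /\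
    forall A : set R, measurable A -> nu A = normal_prob m s A.

(* Main.v *)
From HB Require Import structures.
Require Import Defs.
From mathcomp Require Import zify ring lra.

(* Existence of Y.  For n >= m the second moment of the centered sum
   S_n - E S_n is a constant 2 tau, because sigma^2 = 0; polarizing, two
   centered sums over adjacent blocks of lengths >= m have covariance - tau.
   Hence, with L = m + 1, the averages over i <= N of the centered sums
   X_(k+1) + ... + X_(k+Li) form a Cauchy sequence in L^2, and Y_k is minus
   their limit along N = 4^j, where the convergence is almost sure.  Telescoping
   gives Y_k - Y_(k-1) = X_k - mu.  By the same covariances, the averages of the
   sums over the symmetric blocks (k - Li, k + Li] tend to 0, so Y_k is also the
   limit of the averages of X_(k-Li+1) + ... + X_k.  Thus Y_k depends, up to null
   events, on X_l for l <= k only, and on X_l for l > k only, which makes Y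
   (m-1)-dependent.

   Given Y, S_n - E S_n = Y_n - Y_0 almost surely, and Y_n is independent of Y_0
   for n >= m.

   Normality.  If Y_n - Y_0 is normal with variance 2c, all moment generating
   functions are finite, and M, the moment generating function of Y_0, is an
   entire function with M(s) M(-s) = exp (c s^2).  So M has the entire inverse
   M(-s) exp (- c s^2), and its growth is at most exp (K |s|^2).  By Hadamard's
   theorem (here: write M = e^f and bound the Taylor coefficients of f by
   averaging Re f over the circles) f is a polynomial of degree at most 2, and
   the moment generating function determines the law. *)

Set Implicit Arguments.
Unset Strict Implicit.
Unset Printing Implicit Defensive.

Import Order.TTheory GRing.Theory Num.Theory.
Import numFieldNormedType.Exports.

Local Open Scope classical_set_scope.
Local Open Scope ring_scope.

(** * Everywhere convergent real power series *)

(** Complex analysis is done over the reals. An entire function with real coefficients is its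
    coefficient sequence; on the ray of angle t its real and imaginary parts are the series with
    coefficients a_n cos (n t) and a_n sin (n t). A circle average becomes a finite average over the
    N-th roots of unity, exact for frequencies below N. No logarithm of M is chosen: F = M' / M is
    entire because M has an entire inverse, and f is F integrated term by term.

    The moment generating function determines the law through the moments: they give all integrals
    of cos (s x + a), averaging these over a Gaussian frequency s gives Gaussian convolutions, and
    these approximate Lipschitz functions, hence distribution functions.

    In the construction of Y, L = m + 1 serves twice: the blocks have length at least m, and the
    X_(k+Li) are pairwise uncorrelated, so their averages vanish in the telescoping. Along N = 4^j
    the increments have squared norm O(4^-j), which gives summability. An almost sure limit would
    leave Y_k undefined on a null set; an upper limit makes it a functional of every path, commuting
    with all shifts. *)

Section entire_series.
Variable R : realType.
Implicit Types (a b p q : R^nat) (r s t : R).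

Definition entire a := forall r, cvgn (pseries a r).
Definition psum a r := limn (pseries a r).
Definition conv a b : R^nat := fun n => \sum_(i < n.+1) a i * b (n - i)%N.

Lemma cvg_psum a r : entire a -> pseries a r @ \oo --> psum a r.
Proof. by move=> ea; exact: ea. Qed.

Lemma entire_norm a : entire a -> entire (fun n => `|a n|).
Proof.
move=> ea r; apply: (is_cvg_pseries_inside_norm (ea (`|r| + 1))).
by rewrite [ltRHS]ger0_norm ?addr_ge0// ltrDl.
Qed.

Lemma entire_bounded a r : entire a -> 0 <= r ->
  forall n, pseries (fun n => `|a n|) r n <= psum (fun n => `|a n|) r.
Proof.
move=> /entire_norm/(_ r) ea r0 n; apply: nondecreasing_cvgn_le => //.
by apply: nondecreasing_series => i _ _; rewrite mulr_ge0// exprn_ge0.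
Qed.

(** Convergence at [|r| + 1] gives convergence at [r], so radii below 1 need no check. For [1 <= r]
    the powers of [r] increase, which [entire_diffs] uses. *)
Lemma bounded_entire a :
  (forall r, 1 <= r -> exists K, forall n, pseries (fun n => `|a n|) r n <= K) ->
  entire a.
Proof.
move=> ba r; have r1 : 1 <= `|r| + 1 by rewrite lerDr.
have [K bK] := ba _ r1.
apply: (@is_cvg_pseries_inside _ a (`|r| + 1)); last first.
  by rewrite [ltRHS]ger0_norm ?addr_ge0// ltrDl.
apply: normed_cvg.
apply: nondecreasing_is_cvgn.
  by apply: nondecreasing_series => i _ _ /=; rewrite normr_ge0.
exists K => _ [n _ <-]; rewrite (le_trans _ (bK n))//.
apply: ler_sum => i _ /=; rewrite normrM normrX ler_wpM2l//.
by rewrite [X in X ^+ _]ger0_norm// addr_ge0.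
Qed.

Lemma entire_le a b : (forall n, `|a n| <= `|b n|) -> entire b -> entire a.
Proof.
move=> ab eb; apply: bounded_entire => r r1.
have r0 : 0 <= r by rewrite (le_trans _ r1).
exists (psum (fun n => `|b n|) r) => n.
apply: le_trans (entire_bounded eb r0 n); apply: ler_sum => i _ /=.
by rewrite ler_wpM2r// exprn_ge0.
Qed.

Lemma psumD a b r : entire a -> entire b ->
  psum (fun n => a n + b n) r = psum a r + psum b r.
Proof.
move=> ea eb; apply: cvg_lim => //.
rewrite (_ : pseries _ r = pseries a r \+ pseries b r); last first.
  apply/funext => n /=; rewrite /pseries/= -big_split/=.
  by apply: eq_bigr => i _; rewrite mulrDl.
by apply: cvgD; exact: cvg_psum.
Qed.

Lemma psumB a b r : entire a -> entire b ->
  psum (fun n => a n - b n) r = psum a r - psum b r.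
Proof.
move=> ea eb; apply: cvg_lim => //.
rewrite (_ : pseries _ r = pseries a r \- pseries b r); last first.
  apply/funext => n /=; rewrite /pseries/= -sumrB/=.
  by apply: eq_bigr => i _; rewrite mulrBl.
by apply: cvgB; exact: cvg_psum.
Qed.

Lemma psum_norm_le a r : entire a ->
  `|psum a r| <= psum (fun n => `|a n|) `|r|.
Proof.
move=> ea.
have h := @entire_norm _ ea `|r|.
rewrite (_ : psum _ `|r| = limn [normed pseries a r]); last first.
  congr (limn _); apply/funext => n; apply: eq_bigr => i _ /=.
  by rewrite normrM normrX.
apply: lim_series_norm; rewrite (_ : [normed _] = pseries (fun n => `|a n|) `|r|)//.
apply/funext => n; apply: eq_bigr => i _ /=.
by rewrite normrM normrX.
Qed.

Lemma psum_norm_incr a b r : (forall n, `|a n| <= `|b n|) -> entire b -> 0 <= r ->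
  psum (fun n => `|a n|) r <= psum (fun n => `|b n|) r.
Proof.
move=> ab eb r0; apply: limr_le.
  exact/entire_norm/(entire_le ab).
near=> n; apply: le_trans (entire_bounded eb r0 n); apply: ler_sum => i _ /=.
by rewrite ler_wpM2r// exprn_ge0.
Unshelve. all: by end_near. Qed.

Lemma psum0 a : psum a 0 = a 0%N.
Proof.
rewrite /psum; apply: lim_near_cst => //; near=> n.
rewrite -[n]prednK; last by near: n; exact: nbhs_infty_gt.
rewrite /pseries/= /series/= big_nat_recl//= expr0 mulr1 big1 ?addr0// => i _.
by rewrite expr0n mulr0.
Unshelve. all: by end_near. Qed.

(** Since [n.+1 <= 2 ^ n.+1], the differentiated series at [r] is dominated by the series of [a] at
    [2 * r]. *)
Lemma entire_diffs a : entire a -> entire (pseries_diffs a).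
Proof.
move=> ea; apply: bounded_entire => r r1.
have r0 : 0 <= r by rewrite (le_trans _ r1).
have r20 : 0 <= 2 * r by rewrite mulr_ge0.
exists (psum (fun n => `|a n|) (2 * r)) => n.
apply: le_trans (entire_bounded ea r20 n.+1).
rewrite /pseries/= /series/= big_nat_recl//= -[leLHS]add0r; apply: lerD.
  by rewrite mulr_ge0.
apply: ler_sum => i _; rewrite /pseries_diffs normrM mulrAC mulrC.
rewrite ler_wpM2l//; rewrite normr_nat exprMn; apply: ler_pM => //.
- by rewrite exprn_ge0.
- by rewrite -natrX ler_nat (ltnW (ltn_expl _ _)).
- by rewrite exprS ler_peMl// exprn_ge0.
Qed.

Lemma is_derive_psum a r : entire a ->
  is_derive r 1 (psum a) (psum (pseries_diffs a) r).
Proof.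
move=> ea; have ea1 := entire_diffs ea; have ea2 := entire_diffs ea1.
apply: (@pseries_snd_diffs _ _ (`|r| + 1)); [exact: ea|exact: ea1|exact: ea2|].
by rewrite [ltRHS]ger0_norm ?addr_ge0// ltrDl.
Qed.

Lemma psum_diffs_eq a b : entire a -> entire b -> psum a = psum b ->
  psum (pseries_diffs a) = psum (pseries_diffs b).
Proof.
move=> ea eb ab; apply/funext => r.
have := is_derive_psum r ea; rewrite ab => d1.
by rewrite -(derive_val (is_derive := d1)); have d2 := is_derive_psum r eb; rewrite derive_val.
Qed.

(** The value at 0 gives the constant term, and differentiation lowers the index of every other
    coefficient by one. *)
Lemma psum_inj a b : entire a -> entire b -> psum a = psum b -> a = b.
Proof.
move=> ea eb ab; apply/funext => n.
elim: n a b ea eb ab => [|n IH] a b ea eb ab.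
  by rewrite -psum0 -[RHS]psum0 ab.
have := IH _ _ (entire_diffs ea) (entire_diffs eb) (psum_diffs_eq ea eb ab).
by rewrite /pseries_diffs => /mulfI; apply; rewrite pnatr_eq0.
Qed.

(** Partial sums as polynomials, so that the product of two partial sums is governed by [coefM]. *)
Let trunc N a : {poly R} := \poly_(i < N) a i.

Let pseries_trunc N a r : pseries a r N = (trunc N a).[r].
Proof. by rewrite horner_poly /pseries/= /series/= big_mkord. Qed.

Let trunc_mul N a b n : (n < N)%N -> (trunc N a * trunc N b)`_n = conv a b n.
Proof.
move=> nN; rewrite coefM; apply: eq_bigr => i _; rewrite !coef_poly.
have iN : (i < N)%N by rewrite (leq_ltn_trans _ nN)// -ltnS.
by rewrite iN (leq_ltn_trans _ nN)// leq_subr.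
Qed.

Let trunc_mul_norm N a b n :
  `|(trunc N a * trunc N b)`_n| <= conv (fun n => `|a n|) (fun n => `|b n|) n.
Proof.
rewrite coefM; apply: le_trans (ler_norm_sum _ _ _) _; apply: ler_sum => i _.
rewrite normrM !coef_poly; apply: ler_pM => //.
  by case: ifP => // _; rewrite normr0.
by case: ifP => // _; rewrite normr0.
Qed.

Let horner_trunc_mul N a b r : pseries a r N * pseries b r N =
  \sum_(0 <= n < N + N) (trunc N a * trunc N b)`_n * r ^+ n.
Proof.
rewrite !pseries_trunc -hornerM (@horner_coef_wide _ (N + N)) ?big_mkord//.
apply: leq_trans (size_polyMleq _ _) _; rewrite (leq_trans (leq_pred _))//.
by apply: leq_add; exact: size_poly.
Qed.

Let conv_norm_bound a b r N : entire a -> entire b -> 0 <= r ->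
  pseries (conv (fun n => `|a n|) (fun n => `|b n|)) r N <=
  psum (fun n => `|a n|) r * psum (fun n => `|b n|) r.
Proof.
move=> ea eb r0.
apply: (@le_trans _ _ (pseries (fun n => `|a n|) r N * pseries (fun n => `|b n|) r N)).
  rewrite horner_trunc_mul (@big_cat_nat _ _ _ N)//= ?leq_addr// -[leLHS]addr0.
  apply: lerD.
    rewrite /pseries/= /series/= !big_nat ler_sum// => i /andP[_ iN].
    by rewrite trunc_mul.
  apply: sumr_ge0 => i _; rewrite mulr_ge0 ?exprn_ge0// coefM sumr_ge0// => j _.
  by rewrite mulr_ge0// coef_poly; case: ifP.
apply: ler_pM; try exact: entire_bounded.
- by apply: sumr_ge0 => i _; rewrite mulr_ge0// exprn_ge0.
- by apply: sumr_ge0 => i _; rewrite mulr_ge0// exprn_ge0.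
Qed.

Lemma conv_norm_le a b n : `|conv a b n| <= conv (fun n => `|a n|) (fun n => `|b n|) n.
Proof.
rewrite /conv; apply: le_trans (ler_norm_sum _ _ _) _.
by apply: ler_sum => i _; rewrite normrM.
Qed.

Lemma entire_conv_norm a b : entire a -> entire b ->
  entire (conv (fun n => `|a n|) (fun n => `|b n|)).
Proof.
move=> ea eb; apply: bounded_entire => r r1.
have r0 : 0 <= r by rewrite (le_trans _ r1).
exists (psum (fun n => `|a n|) r * psum (fun n => `|b n|) r) => N.
apply: le_trans (conv_norm_bound N ea eb r0).
apply: ler_sum => i _ /=; rewrite ger0_norm//.
by apply: sumr_ge0 => j _; rewrite mulr_ge0.
Qed.

Lemma entire_conv a b : entire a -> entire b -> entire (conv a b).
Proof.
move=> ea eb; apply: (entire_le _ (entire_conv_norm ea eb)) => n.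
by rewrite (le_trans (conv_norm_le _ _ _))// ler_norm.
Qed.

(** The product of two [N]-th partial sums has degree below [N + N], and its first [N] coefficients
    are those of [conv a b]. The others are dominated by the slice from [N] to [N + N] of the
    convergent product of the absolute series. *)
Lemma psum_conv a b r : entire a -> entire b ->
  psum (conv a b) r = psum a r * psum b r.
Proof.
move=> ea eb; have ec := entire_conv ea eb.
pose g := pseries (conv (fun n => `|a n|) (fun n => `|b n|)) `|r|.
have gc : g @ \oo --> limn g by apply: (@entire_conv_norm a b).
have g0 : (fun N => g (N + N)%N - g N) @ \oo --> (0 : R).
  rewrite -(subrr (limn g)); apply: cvgB => //.
  apply: (@cvg_comp _ _ _ (fun N => N + N)%N g _ \oo) => //.
  by move=> P [N _ HN]; exists N => //= n /= Nn; apply: HN => /=; rewrite (leq_trans Nn)// leq_addr.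
have h0 : (fun N => pseries a r N * pseries b r N - pseries (conv a b) r N) @ \oo --> (0 : R).
  apply/norm_cvg0P.
  apply: squeeze_cvgr (cvg_cst _) g0.
  near=> N; rewrite normr_ge0/=.
  rewrite horner_trunc_mul (@big_cat_nat _ _ _ N)//= ?leq_addr//.
  rewrite /pseries/= /g /pseries /= {3}/series/=.
  rewrite [X in X + _ - _](_ : _ = \sum_(0 <= n < N) conv a b n * r ^+ n); last first.
    by apply: eq_big_nat => i /andP[_ iN]; rewrite trunc_mul.
  rewrite addrAC subrr add0r sub_series_geq ?leq_addr//.
  apply: le_trans (ler_norm_sum _ _ _) _; apply: ler_sum => i _.
  by rewrite normrM normrX ler_wpM2r ?exprn_ge0// trunc_mul_norm.
have h1 : (fun N => pseries a r N * pseries b r N) @ \oo --> psum a r * psum b r.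
  by apply: cvgM; exact: cvg_psum.
have h2 : (fun N => pseries a r N * pseries b r N - pseries (conv a b) r N) @ \oo -->
    psum a r * psum b r - psum (conv a b) r.
  by apply: cvgB => //; exact: cvg_psum.
apply/esym/eqP; rewrite -subr_eq0; apply/eqP.
exact: (cvg_unique _ h2 h0).
Unshelve. all: by end_near. Qed.

End entire_series.

(** * Entire functions of order at most two *)

Section fourier.
Variable R : realType.
Implicit Types (a b p q : R^nat) (r s t : R).

(** The arguments of the [N]-th roots of unity. *)
Definition unit_angle (N j : nat) : R := pi * (2 * j)%:R / N%:R.

Lemma sum_cos_unit_angle0 N : \sum_(j < N) cos (0%:R * unit_angle N j) = N%:R.
Proof.
under eq_bigr do rewrite mul0r cos0.
by rewrite sumr_const card_ord.
Qed.

Lemma sin_natpi k : sin (k%:R * pi : R) = 0.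
Proof.
elim: k => [|k IH]; first by rewrite mul0r sin0.
by rewrite -natr1 mulrDl mul1r sinD sinpi IH mul0r mulr0 addr0.
Qed.

(** With x = k pi / N, multiplication by 2 sin x makes the sum telescope to sin (2 k pi - x) + sin x
    = 0; and sin x is nonzero because 0 < x < pi. *)
Lemma sum_cos_unit_angle N k : (0 < k < N)%N ->
  \sum_(j < N) cos (k%:R * unit_angle N j) = 0.
Proof.
move=> /andP[k0 kN]; have N0 : (0 < N)%N by apply: leq_ltn_trans kN.
have NR : N%:R != 0 :> R by rewrite pnatr_eq0 -lt0n.
pose x : R := k%:R * pi / N%:R.
have x0 : sin x != 0.
  rewrite gt_eqF// sin_gt0_pi// /x divr_gt0 ?mulr_gt0 ?ltr0n ?pi_gt0//=.
  by rewrite ltr_pdivrMr ?ltr0n// mulrC ltr_pM2l ?pi_gt0// ltr_nat.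
suff : 2 * sin x * (\sum_(j < N) cos (k%:R * unit_angle N j)) = 0.
  move=> /eqP; rewrite mulf_eq0 mulf_eq0 (negbTE x0) orbF pnatr_eq0/=.
  by move=> /eqP.
pose f j : R := sin ((2 * j)%:R * x - x).
rewrite mulr_sumr (eq_bigr (fun j : 'I_N => f j.+1 - f j)); last first.
  move=> j _; rewrite /f.
  have -> : k%:R * unit_angle N j = (2 * j)%:R * x.
    by rewrite /unit_angle /x; field.
  have -> : (2 * j.+1)%:R * x - x = (2 * j)%:R * x + x.
    by rewrite mulnS natrD; ring.
  by rewrite sinD sinB; ring.
rewrite -(big_mkord xpredT (fun j => f j.+1 - f j)) telescope_sumr//.
rewrite /f muln0 mul0r sub0r.
have -> : (2 * N)%:R * x = (2 * k)%:R * pi by rewrite /x !natrM; field.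
rewrite sinB sin_natpi mul0r sub0r natrM -mulrA mulr_natl.
rewrite cos_mulr2n cos2sin2 sin_natpi expr0n subr0 sinN.
by ring.
Qed.

(** Discrete orthogonality. The product formula produces the frequencies [k + n] and |k - n|, the
    latter written [maxn k n - minn k n]; the bound [k + n < N] excludes aliasing. *)
Lemma sum_cos_mul N k n (e : R) : (0 < k)%N -> (0 < n)%N -> (k + n < N)%N ->
  \sum_(j < N) cos (k%:R * unit_angle N j) * (1 + e * cos (n%:R * unit_angle N j)) =
  if k == n then e / 2 * N%:R else 0.
Proof.
move=> k0 n0 knN.
have kN : (0 < k < N)%N by rewrite k0 (leq_ltn_trans _ knN)// leq_addr.
pose F m := \sum_(j < N) cos (m%:R * unit_angle N j).
have cosP (x y : R) : cos x * cos y = (cos (x + y) + cos (x - y)) / 2.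
  by rewrite cosD cosB; field.
have -> : \sum_(j < N) cos (k%:R * unit_angle N j) * (1 + e * cos (n%:R * unit_angle N j)) =
  F k + e / 2 * (F (k + n)%N + F (maxn k n - minn k n)%N).
  rewrite /F -big_split/= mulr_sumr -big_split/=; apply: eq_bigr => j _.
  rewrite mulrDr mulr1; congr (_ + _).
  rewrite mulrCA cosP -mulrDl -natrD mulrA mulrAC; congr (_ / 2 * (_ + _)).
  rewrite -mulrBl; have [kn|nk] := leqP k n.
    by rewrite -cosN -mulNr opprB -natrB// (maxn_idPr kn) (minn_idPl kn).
  by rewrite -natrB ?(ltnW nk)// (maxn_idPl (ltnW nk)) (minn_idPr (ltnW nk)).
rewrite {1}/F sum_cos_unit_angle// add0r.
rewrite {1}/F sum_cos_unit_angle ?addn_gt0 ?k0 ?knN// add0r.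
case: eqVneq => [->|kn]; first by rewrite maxnn minnn subnn /F sum_cos_unit_angle0.
rewrite /F sum_cos_unit_angle ?mulr0//; apply/andP; split; last first.
  by rewrite (leq_ltn_trans (leq_subr _ _))// gtn_max; apply/andP; split; lia.
by rewrite subn_gt0; lia.
Qed.

Lemma sum_1cos N n (e : R) : (0 < n < N)%N ->
  \sum_(j < N) (1 + e * cos (n%:R * unit_angle N j)) = N%:R.
Proof.
move=> nN; rewrite big_split/= -mulr_sumr sum_cos_unit_angle// mulr0 addr0.
by rewrite sumr_const card_ord.
Qed.

(** The weights [1 + e * cos (n t)] are nonnegative with mean 1, so averaging against them preserves
    a one-sided bound on the real part, while orthogonality isolates [e / 2 * b n * r ^+ n]. The
    signs [e = 1] and [e = -1] together bound the modulus of [b n]. *)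
Lemma fourier_coef_le b (K r e : R) n : entire b -> b 0%N = 0 ->
  0 <= r -> (0 < n)%N -> `|e| = 1 ->
  (forall t, psum (fun k => b k * cos (k%:R * t)) r <= K) ->
  e * b n * r ^+ n <= 2 * K.
Proof.
move=> eb b0 r0 n0 e1 bK.
apply/ler_addgt0Pr => d d0.
have d80 : 0 < d / 8 by rewrite divr_gt0.
have eba : entire (fun n => `|b n|) by apply: entire_norm.
pose A := psum (fun n => `|b n|) r.
have [L AL] : exists L, A - d / 8 <= pseries (fun n => `|b n|) r L.
  have : pseries (fun n => `|b n|) r @ \oo --> A by exact: cvg_psum.
  move=> /cvgrPdist_le/(_ _ d80)[L _ HL]; exists L.
  by have := HL L (leqnn _); rewrite ler_norml => /andP[_]; lra.
(* [N] exceeds [k + n] for all [k <= L + n], so there is no aliasing before the index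
   [L' = (L + n).+1] used below; from [L] on, the absolute series contributes at most [d / 8]. *)
pose N := (L + n + n).+1.
have N0 : (0 : R) < N%:R by rewrite ltr0n.
pose w j := 1 + e * cos (n%:R * unit_angle N j).
have ecos x : `|e * cos x| <= 1 by rewrite normrM e1 mul1r cos_max.
have w0 j : 0 <= w j.
  by have := ecos (n%:R * unit_angle N j); rewrite ler_norml => /andP[h _]; rewrite /w; lra.
have w2 j : w j <= 2.
  by have := ecos (n%:R * unit_angle N j); rewrite ler_norml => /andP[_ h]; rewrite /w; lra.
pose bc t k := b k * cos (k%:R * t).
have ebc t : entire (bc t).
  apply: (entire_le _ eb) => k; rewrite normrM ler_piMr//.
  exact: cos_max.
pose S := \sum_(j < N) w j * psum (bc (unit_angle N j)) r.
have SK : S <= N%:R * K.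
  rewrite -(@sum_1cos N n e) ?n0/=; last by rewrite /N; lia.
  by rewrite /S mulr_suml; apply: ler_sum => j _; apply: ler_wpM2l; [exact: w0|exact: bK].
have Slim : (fun M => \sum_(j < N) w j * pseries (bc (unit_angle N j)) r M) @ \oo --> S.
  by apply: cvg_big => [|j _]; [exact: add_continuous|apply: cvgMr; exact: cvg_psum].
have Sge : e / 2 * N%:R * b n * r ^+ n - 2 * N%:R * (d / 8) <= S.
  apply: (cvgr_to_ge Slim); near=> M.
  pose W k := \sum_(j < N) cos (k%:R * unit_angle N j) * w j.
  have W2 k : `|W k| <= 2 * N%:R.
    rewrite /W (le_trans (ler_norm_sum _ _ _))//.
    apply: (@le_trans _ _ (\sum_(j < N) 2)); last by rewrite sumr_const card_ord mulr_natr.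
    apply: ler_sum => j _.
    rewrite normrM -[leRHS]mul1r; apply: ler_pM => //; first exact: cos_max.
    by rewrite ger0_norm.
  have -> : \sum_(j < N) w j * pseries (bc (unit_angle N j)) r M =
      \sum_(0 <= k < M) b k * r ^+ k * W k.
    rewrite /pseries/= /series/=.
    under eq_bigr do rewrite mulr_sumr.
    rewrite exchange_big/=; apply: eq_bigr => k _.
    by rewrite /W mulr_sumr; apply: eq_bigr => j _; rewrite /bc; ring.
  pose L' := (L + n).+1.
  have L'M : (L' <= M)%N by near: M; exact: nbhs_infty_ge.
  rewrite (@big_cat_nat _ _ _ L')//=; apply: lerD.
    rewrite big_mkord (bigD1 (@Ordinal L' n _))//=; first by rewrite /L'; lia.
    move=> nL'; rewrite big1 ?addr0.
      by rewrite /W sum_cos_mul ?eqxx /N; [lra|lia|lia|lia].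
    move=> [k kL'] /=; rewrite -val_eqE/= => kn.
    have [->|k0] := posnP k; first by rewrite b0 !mul0r.
    by rewrite /W sum_cos_mul ?(negbTE kn) ?mulr0 /N//; move: kL'; rewrite /L'; lia.
  rewrite lerNl -sumrN.
  (* Aliased frequencies are not evaluated: each weighted sum [W k] is at most [2 * N%:R], and the
     coefficients from [L'] on are small in total. *)
  apply: (@le_trans _ _ (\sum_(L' <= k < M) `|b k| * r ^+ k * (2 * N%:R))).
    apply: ler_sum => k _; apply: le_trans (ler_norm _) _.
    by rewrite normrN !normrM normrX (ger0_norm r0) ler_wpM2l// mulr_ge0// exprn_ge0.
  rewrite -mulr_suml mulrC; apply: ler_wpM2l; first by rewrite mulr_ge0.
  have := entire_bounded eb r0 M; rewrite -/A => MA.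
  have LL' : pseries (fun n => `|b n|) r L <= pseries (fun n => `|b n|) r L'.
    apply: nondecreasing_series => [i _ _|]; first by rewrite mulr_ge0// exprn_ge0.
    by rewrite /L'; lia.
  have := sub_series_geq (fun n => `|b n| * r ^+ n) L'M.
  rewrite /pseries/= in MA LL' AL; lra.
have : N%:R * (e / 2 * b n * r ^+ n - 2 * (d / 8)) <= N%:R * K.
  by apply: le_trans SK; apply: le_trans Sge; lra.
by rewrite ler_pM2l//; lra.
Unshelve. all: by end_near. Qed.


(** By [fourier_coef_le], |b_n| r^n is at most 2 K (1 + r^2), which for n >= 3 forces b_n = 0 as r
    grows. *)
Lemma fourier_liouville b (K : R) n : entire b -> b 0%N = 0 -> (3 <= n)%N ->
  (forall r t, 0 <= r -> psum (fun k => b k * cos (k%:R * t)) r <= K * (1 + r ^+ 2)) ->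
  b n = 0.
Proof.
move=> eb b0 n3 bK; apply/eqP; rewrite -normr_le0; apply/ler_addgt0Pr => d d0.
rewrite add0r.
have n0 : (0 < n)%N by apply: leq_trans n3.
have K0 : 0 <= K.
  have := bK 0 0 (lexx _).
  by rewrite psum0 b0 mul0r expr0n addr0 mulr1.
(* Chosen so that [d * r >= 4 * K]: the estimate [|b n| * r <= 4 * K] then yields [|b n| <= d]. *)
pose r := 1 + 4 * K / d.
have r1 : 1 <= r by rewrite lerDl divr_ge0 ?mulr_ge0// ltW.
have r0 : 0 <= r by apply: le_trans r1.
have h : `|b n| * r ^+ n <= 2 * (K * (1 + r ^+ 2)).
  have [bn0|bn0] := leP 0 (b n).
    rewrite ger0_norm// -[b n]mul1r; apply: fourier_coef_le => //.
      by rewrite normr1.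
    by move=> t; exact: bK.
  rewrite ltr0_norm// -mulN1r; apply: fourier_coef_le => //.
    by rewrite normrN1.
  by move=> t; exact: bK.
have r2 : 1 <= r ^+ 2 by rewrite expr_ge1.
have h2 : `|b n| * r * r ^+ 2 <= 4 * K * r ^+ 2.
  rewrite -mulrA -exprS; apply: (@le_trans _ _ (`|b n| * r ^+ n)).
    by rewrite ler_wpM2l// ler_weXn2l.
  apply: le_trans h _; have : K * 1 <= K * r ^+ 2 by rewrite ler_wpM2l.
  by lra.
have {}h2 : `|b n| * r <= 4 * K.
  by rewrite -(@ler_pM2r _ (r ^+ 2))// (lt_le_trans _ r2).
have rp : 0 < r by apply: lt_le_trans r1.
rewrite -(@ler_pM2r _ r)//; apply: le_trans h2 _.
rewrite /r mulrDr mulr1 mulrCA divff ?gt_eqF// mulr1; lra.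
Qed.

(* P' = F P with F = f', so |P(r e^(it))|^2 = exp (2 Re f) along each ray. *)
Lemma entire_log_bound p q (A B : R) r t :
  entire p -> entire q -> p 0%N = 1 ->
  (forall s, psum p s * psum q s = 1) ->
  let F := conv (pseries_diffs p) q in
  (forall r, 0 <= r -> psum (fun n => `|p n|) r <= expR (A + B * r ^+ 2)) ->
  0 <= r ->
  psum (fun k => F k.-1 / k%:R * cos (k%:R * t)) r <= 1 + A + B * r ^+ 2.
Proof.
move=> ep eq p0 pq F pAB r0.
have edp := entire_diffs ep.
have eF : entire F by exact: entire_conv.
have FP : conv F p = pseries_diffs p.
  apply: psum_inj => //; first exact: entire_conv.
  apply/funext => s; rewrite psum_conv// psum_conv// -mulrA [psum q _ * _]mulrC pq.
  by rewrite mulr1.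
have pr_le (a b : R^nat) : (forall n, exists2 x, a n = b n * x & `|x| <= 1) -> entire b -> entire a.
  move=> ab eb; apply: (entire_le _ eb) => n; have [x -> x1] := ab n.
  by rewrite normrM ler_piMr.
(* As series in r: [c] and [s] are the real and imaginary parts of P(r e^(it)), [gc] and [gs] those
   of e^(it) F(r e^(it)), the radial derivative of f, and [u] is the real part of f. *)
pose c n := p n * cos (n%:R * t).
pose s n := p n * sin (n%:R * t).
pose gc n := F n * cos (n.+1%:R * t).
pose gs n := F n * sin (n.+1%:R * t).
pose u k := F k.-1 / k%:R * cos (k%:R * t).
have ec : entire c by apply: (pr_le _ p) => // n; exists (cos (n%:R * t)) => //; exact: cos_max.
have es : entire s by apply: (pr_le _ p) => // n; exists (sin (n%:R * t)) => //; exact: sin_max.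
have egc : entire gc by apply: (pr_le _ F) => // n; exists (cos (n.+1%:R * t)) => //; exact: cos_max.
have egs : entire gs by apply: (pr_le _ F) => // n; exists (sin (n.+1%:R * t)) => //; exact: sin_max.
have eu : entire u.
  apply: bounded_entire => x x1; have x0 : 0 <= x by apply: le_trans x1.
  exists (x * psum (fun n => `|F n|) x) => -[|n].
    rewrite /pseries/= /series/= big_geq// mulr_ge0//.
    by apply: le_trans (entire_bounded eF x0 0); rewrite /pseries/= /series/= big_geq.
  rewrite /pseries/= /series/= big_nat_recl//= {1}/u invr0 mulr0 mul0r normr0 mul0r add0r.
  apply: (@le_trans _ _ (x * pseries (fun n => `|F n|) x n)).
    rewrite /pseries/= /series/= mulr_sumr; apply: ler_sum => i _.
    rewrite exprS mulrCA ler_wpM2l// ler_wpM2r ?exprn_ge0// /u/=.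
    rewrite !normrM -mulrA ler_piMr// mulr_ile1// ?cos_max//.
    by rewrite ger0_norm ?invr_ge0// invf_le1 ?ltr0n// ler1n.
  by rewrite ler_wpM2l// entire_bounded.
have dc : pseries_diffs c = (fun n => conv gc c n - conv gs s n).
  apply/funext => n; rewrite /pseries_diffs /c /conv -sumrB mulrA.
  have -> : n.+1%:R * p n.+1 = conv F p n by rewrite FP.
  rewrite mulr_suml; apply: eq_bigr => -[i /= ni] _.
  have -> : n.+1%:R * t = i.+1%:R * t + (n - i)%:R * t.
    by rewrite -mulrDl -natrD addSn subnKC// -ltnS.
  by rewrite cosD /gc /gs /s; ring.
have ds : pseries_diffs s = (fun n => conv gs c n + conv gc s n).
  apply/funext => n; rewrite /pseries_diffs /s /conv -big_split/= mulrA.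
  have -> : n.+1%:R * p n.+1 = conv F p n by rewrite FP.
  rewrite mulr_suml; apply: eq_bigr => -[i /= ni] _.
  have -> : n.+1%:R * t = i.+1%:R * t + (n - i)%:R * t.
    by rewrite -mulrDl -natrD addSn subnKC// -ltnS.
  by rewrite sinD /gc /gs /c; ring.
have du : pseries_diffs u = gc.
  apply/funext => n; rewrite /pseries_diffs /u /gc/=.
  by rewrite mulrA mulrCA divff ?pnatr_eq0// mulr1.
(* |P|^2 exp (- 2 Re f) is constant along the ray, and equals 1 at the origin because [p 0 = 1] and
   f vanishes there. *)
pose h x := (psum c x ^+ 2 + psum s x ^+ 2) * expR (- 2 * psum u x).
have hE : h r = h 0.
  apply: is_derive_0_is_cst => x.
  have d1 := is_derive_psum x ec.
  have d2 := is_derive_psum x es.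
  have d3 := is_derive_psum x eu.
  rewrite dc psumB ?psum_conv// in d1; [|exact: entire_conv|exact: entire_conv].
  rewrite ds psumD ?psum_conv// in d2; [|exact: entire_conv|exact: entire_conv].
  rewrite du in d3.
  have -> : h = (psum c ^+ 2 + psum s ^+ 2) * (expR \o (-2 \*: psum u)).
    by apply/funext.
  apply: (is_derive_eq (is_deriveM (is_deriveD (is_deriveX 2 d1) (is_deriveX 2 d2))
    (is_derive1_comp (is_derive_expR _) (is_deriveZ (-2) d3)))).
  have -> : (psum c ^+ 2 + psum s ^+ 2) x = psum c x ^+ 2 + psum s x ^+ 2 by [].
  have -> : (-2 \*: psum u) x = -2 * psum u x by [].
  have -> : (expR \o -2 \*: psum u) x = expR (-2 * psum u x) by [].
  by rewrite /GRing.scale/= !expr1; ring.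
have h1 : psum c r ^+ 2 + psum s r ^+ 2 = expR (2 * psum u r).
  move: hE; rewrite /h !psum0 /c /s /u !mul0r cos0 sin0 p0 invr0 !(mulr0, mul0r) expR0.
  rewrite !mulr1 expr1n expr0n addr0.
  rewrite mulNr expRN => /eqP.
  by rewrite -[X in _ == X](@divff _ (expR (2 * psum u r))) ?expR_eq0// => /eqP/divIf; apply; rewrite expR_eq0.
have hp (a : R^nat) : (forall n, exists2 x, a n = p n * x & `|x| <= 1) ->
    psum a r ^+ 2 <= expR (2 * (A + B * r ^+ 2)).
  move=> ap; rewrite -[leLHS]ger0_norm ?sqr_ge0// normrX mulr_natl mulr2n expRD -expr2.
  rewrite lerXn2r ?nnegrE ?expR_ge0//.
  apply: le_trans (pAB _ r0); apply: le_trans (psum_norm_le _ (pr_le _ _ ap ep)) _.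
  rewrite ger0_norm//; apply: psum_norm_incr => // n; have [x -> x1] := ap n.
  by rewrite normrM ler_piMr.
have : expR (2 * psum u r) <= expR (2 * (1 + A + B * r ^+ 2)).
  (* Bounding the real and imaginary parts separately costs a factor 2, at most e^2; this is the
     summand 1 in the conclusion. *)
  rewrite -h1; apply: (@le_trans _ _ (2 * expR (2 * (A + B * r ^+ 2)))).
    rewrite mulr_natl mulr2n; apply: lerD; apply: hp => n.
      by exists (cos (n%:R * t)) => //; exact: cos_max.
    by exists (sin (n%:R * t)) => //; exact: sin_max.
  have -> : 2 * (1 + A + B * r ^+ 2) = 2 + 2 * (A + B * r ^+ 2) by ring.
  rewrite expRD ler_wpM2r ?expR_ge0//.
  by apply: le_trans (expR_ge1Dx _); lra.
by rewrite ler_expR ler_pM2l.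
Qed.

(** Hadamard's theorem for a function without zeros. The inverse [q] makes F = p' q the logarithmic
    derivative; the growth bound kills its coefficients of index at least 2, so F is affine, and p'
    = F p integrates to the exponential of a quadratic. *)
Lemma entire_order2_exp p q (A B : R) :
  entire p -> entire q -> p 0%N = 1 ->
  (forall s, psum p s * psum q s = 1) ->
  (forall r, 0 <= r -> psum (fun n => `|p n|) r <= expR (A + B * r ^+ 2)) ->
  exists a b : R, forall s, psum p s = expR (a * s + b * s ^+ 2).
Proof.
move=> ep eq p0 pq pAB.
have edp := entire_diffs ep.
pose F := conv (pseries_diffs p) q.
have eF : entire F by exact: entire_conv.
(* The coefficients of the primitive of F that vanishes at 0: for [k = 0] the division by zero
   returns 0, the desired constant term. *)
pose b k := F k.-1 / k%:R.
have eb : entire b.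
  apply: bounded_entire => x x1; have x0 : 0 <= x by apply: le_trans x1.
  exists (`|b 0%N| + x * psum (fun n => `|F n|) x) => -[|n].
    rewrite /pseries/= /series/= big_geq// addr_ge0// mulr_ge0//.
    by apply: le_trans (entire_bounded eF x0 0); rewrite /pseries/= /series/= big_geq.
  rewrite /pseries/= /series/= big_nat_recl//= expr0 mulr1 lerD2l.
  apply: (@le_trans _ _ (x * pseries (fun n => `|F n|) x n)).
    rewrite /pseries/= /series/= mulr_sumr; apply: ler_sum => i _.
    rewrite exprS mulrCA ler_wpM2l// ler_wpM2r ?exprn_ge0// /b/=.
    rewrite !normrM ler_piMr// ger0_norm ?invr_ge0//.
    by rewrite invf_le1 ?ltr0n// ler1n.
  by rewrite ler_wpM2l// entire_bounded.
have F0 n : (2 <= n)%N -> F n = 0.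
  move=> n2; have := @fourier_liouville b (`|1 + A| + `|B|) n.+1 eb.
  rewrite /b/= invr0 mulr0 => /(_ erefl n2) h.
  have /eqP : F n / n.+1%:R = 0.
    apply: h => r t r0; apply: le_trans (entire_log_bound t ep eq p0 pq pAB r0) _.
    have := ler_norm (1 + A); have := ler_norm B; have := sqr_ge0 r.
    move=> r20 BB AA; rewrite mulrDr mulr1 mulrDl addrACA [leRHS]addrC.
    have : B * r ^+ 2 <= `|B| * r ^+ 2 by rewrite ler_wpM2r.
    have : 0 <= `|1 + A| * r ^+ 2 by rewrite mulr_ge0.
    have := normr_ge0 B.
    lra.
  by rewrite mulf_eq0 invr_eq0 pnatr_eq0 orbF => /eqP.
have FE s : psum F s = F 0%N + F 1%N * s.
  apply: lim_near_cst => //; near=> n.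
  have n2 : (2 <= n)%N by near: n; exact: nbhs_infty_ge.
  rewrite /pseries/= /series/= (@big_cat_nat _ _ _ 2)//= [X in _ + X]big1_seq ?addr0.
    by rewrite big_nat_recl// big_nat1 expr0 expr1 mulr1.
  by move=> i /=; rewrite mem_index_iota => /andP[i2 _]; rewrite F0// mul0r.
have FP s : psum (pseries_diffs p) s = psum F s * psum p s.
  by rewrite psum_conv// -mulrA [psum q _ * _]mulrC pq mulr1.
exists (F 0%N), (F 1%N / 2) => s.
pose h x := psum p x * expR (- (F 0%N * x + F 1%N / 2 * x ^+ 2)).
have hE : h s = h 0.
  apply: is_derive_0_is_cst => x.
  have d1 := is_derive_psum x ep.
  have di := is_derive_id x (1 : R).
  have -> : h = psum p * (expR \o (- (F 0%N \*: id + (F 1%N / 2) \*: (id ^+ 2)))).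
    by apply/funext.
  apply: (is_derive_eq (is_deriveM d1 (is_derive1_comp (is_derive_expR _)
    (is_deriveN (is_deriveD (is_deriveZ (F 0%N) di) (is_deriveZ (F 1%N / 2) (is_deriveX 2 di))))))).
  have -> : (- (F 0%N \*: id + (F 1%N / 2) \*: (id ^+ 2))) x = - (F 0%N * x + F 1%N / 2 * x ^+ 2) by [].
  have -> : (expR \o (- (F 0%N \*: id + (F 1%N / 2) \*: (id ^+ 2)))) x =
    expR (- (F 0%N * x + F 1%N / 2 * x ^+ 2)) by [].
  by rewrite FP FE /GRing.scale/= !expr1; field.
move: hE; rewrite /h psum0 p0 mulr0 expr0n mulr0 addr0 oppr0 expR0 mulr1 expRN => h1.
by apply: (mulIf (invr_neq0 (lt0r_neq0 (expR_gt0 (F 0%N * s + F 1%N / 2 * s ^+ 2))))); rewrite h1 divff// expR_eq0.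
Unshelve. all: by end_near. Qed.

End fourier.

(** * Moment generating functions *)

Section mgf.
Variable R : realType.

Lemma series_exp_le (y : R) N : 0 <= y -> \sum_(0 <= n < N) y ^+ n / n`!%:R <= expR y.
Proof.
move=> y0; have := @nondecreasing_cvgn_le _ (series (exp_coeff y)).
move=> /(_ _ (is_cvg_series_exp_coeff y) N); apply.
by apply: nondecreasing_series => i _ _; rewrite /exp_coeff/= divr_ge0// exprn_ge0.
Qed.

Lemma expr_le_exp (y : R) n : 0 <= y -> y ^+ n <= n`!%:R * expR y.
Proof.
move=> y0; rewrite -ler_pdivrMl ?ltr0n ?fact_gt0// mulrC.
apply: le_trans (series_exp_le n.+1 y0); rewrite big_nat_recr//= lerDr.
by apply: sumr_ge0 => i _; rewrite divr_ge0// exprn_ge0.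
Qed.

Variable mu : probability (measurableTypeR R) R.

Definition finite_mgf := forall s : R, (\int[mu]_x (expR (s * x))%:E < +oo)%E.
Definition mgf (s : R) : R := \int[mu]_x expR (s * x).
Definition moment_coef (n : nat) : R := (\int[mu]_x (x ^+ n)) / n`!%:R.

Hypothesis mu_mgf : finite_mgf.

Lemma measurable_scale (s : R) : measurable_fun [set: measurableTypeR R] (fun x : R => s * x).
Proof. exact: measurable_funM. Qed.

Lemma integrable_expRM (s : R) : mu.-integrable setT (fun x => (expR (s * x))%:E).
Proof.
apply/integrableP; split.
  by apply/measurable_EFinP; apply: measurableT_comp => //; exact: measurable_scale.
under eq_integral do rewrite /= ger0_norm ?expR_ge0//.
exact: mu_mgf.
Qed.

Lemma integrable_expR_norm (s : R) : mu.-integrable setT (fun x => (expR (s * `|x|))%:E).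
Proof.
have := integrableD measurableT (integrable_expRM s) (integrable_expRM (- s)).
apply: le_integrable => //.
  by apply/measurable_EFinP; apply: measurableT_comp => //; apply: measurable_funM.
move=> x _; rewrite -EFinD !abse_EFin lee_fin ger0_norm ?expR_ge0//.
rewrite [leRHS]ger0_norm ?addr_ge0 ?expR_ge0//.
have [x0|x0] := leP 0 x; first by rewrite ger0_norm// lerDl expR_ge0.
by rewrite ltr0_norm// mulNr mulrN lerDr expR_ge0.
Qed.

Lemma integrable_expn n : mu.-integrable setT (fun x => (x ^+ n : R)%:E).
Proof.
have := integrableZl measurableT n`!%:R (integrable_expR_norm 1).
apply: le_integrable => //.
  by apply/measurable_EFinP; exact: measurable_funX.
move=> x _; rewrite -EFinM !abse_EFin lee_fin normrX mul1r.
by rewrite [leRHS]ger0_norm ?mulr_ge0 ?expR_ge0//; exact: expr_le_exp.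
Qed.

Lemma EFin_Rintegral (f : R -> R) : mu.-integrable setT (EFin \o f) ->
  (\int[mu]_x f x)%:E = (\int[mu]_x (f x)%:E)%E.
Proof. by move=> fi; rewrite /Rintegral fineK//; exact: integrable_fin_num. Qed.

Lemma moment_coef_sum_le (r : R) N : 0 <= r ->
  \sum_(0 <= n < N) `|moment_coef n| * r ^+ n <= \int[mu]_x expR (r * `|x|).
Proof.
move=> r0; rewrite -lee_fin -sumEFin EFin_Rintegral; last exact: integrable_expR_norm.
have meas n : measurable_fun [set: measurableTypeR R] (fun x : R => (`|x| ^+ n * (r ^+ n / n`!%:R))).
  by apply: measurable_funM => //; exact: measurable_funX.
apply: (@le_trans _ _ (\sum_(0 <= n < N) \int[mu]_x (`|x| ^+ n * (r ^+ n / n`!%:R))%:E)%E).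
  apply: lee_sum => n _.
  have in1 : mu.-integrable setT (fun x : measurableTypeR R => (`|x| ^+ n)%:E : \bar R).
    apply: eq_integrable (integrable_abse (integrable_expn n)) => // x _ /=.
    by rewrite normrX.
  rewrite -EFin_Rintegral; last first.
    by apply: eq_integrable (integrableZr measurableT (r ^+ n / n`!%:R) in1) => // x _ /=.
  rewrite lee_fin RintegralZr// mulrA [leRHS]mulrAC ler_wpM2r ?exprn_ge0//.
  rewrite normrM normfV normr_nat ler_wpM2r//.
  apply: le_trans (le_normr_Rintegral _ (integrable_expn n)) _ => //.
  by rewrite le_eqVlt; apply/orP; left; apply/eqP/eq_Rintegral => x _; rewrite normrX.
rewrite -ge0_integral_sum//; last 2 first.
- by move=> n; apply/measurable_EFinP.
- by move=> n x _; rewrite lee_fin !mulr_ge0// ?exprn_ge0.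
apply: ge0_le_integral => //.
- by move=> x _; apply: sume_ge0 => n _; rewrite lee_fin !mulr_ge0// ?exprn_ge0.
- by apply: emeasurable_sum => n; apply/measurable_EFinP.
- by move: (integrable_expR_norm r) => /integrableP[].
- move=> x _; rewrite sumEFin lee_fin; apply: le_trans (series_exp_le N _); last exact: mulr_ge0.
  by apply: ler_sum => i _; rewrite mulrA -exprMn [`|x| * r]mulrC.
Qed.

Lemma entire_moment_coef : entire moment_coef.
Proof.
apply: bounded_entire => r r1; exists (\int[mu]_x expR (r * `|x|)) => n.
by apply: moment_coef_sum_le; rewrite (le_trans _ r1).
Qed.

Lemma psum_norm_moment_coef_le (r : R) : 0 <= r ->
  psum (fun n => `|moment_coef n|) r <= mgf r + mgf (- r).
Proof.
move=> r0; apply: (@le_trans _ _ (\int[mu]_x expR (r * `|x|))).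
  apply: limr_le; first exact/entire_norm/entire_moment_coef.
  by apply: nearW => N; exact: moment_coef_sum_le.
rewrite -RintegralD//; [|exact: integrable_expRM|exact: integrable_expRM].
apply: le_Rintegral => //; first exact: integrable_expR_norm.
  apply: eq_integrable (integrableD measurableT (integrable_expRM r) (integrable_expRM (- r))) => //.
move=> x _.
have [x0|x0] := leP 0 x; first by rewrite ger0_norm// lerDl expR_ge0.
by rewrite ltr0_norm// mulNr mulrN lerDr expR_ge0.
Qed.

(** One statement for exp, cos and sin: as [|c n| <= 1], every partial sum at [s * x] is at most
    [expR (|s| * |x|)], and dominated convergence allows integration term by term. *)
Lemma integral_entire_exp (c : R^nat) (f : R -> R) (s : R) :
  (forall n, `|c n| <= 1) -> measurable_fun [set: measurableTypeR R] f ->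
  (forall x, pseries (fun n => c n / n`!%:R) x @ \oo --> f x) ->
  mu.-integrable setT (fun x => (f (s * x))%:E) /\
  \int[mu]_x f (s * x) = psum (fun n => c n * moment_coef n) s.
Proof.
move=> c1 mf fE.
pose g N (x : measurableTypeR R) : \bar R := (pseries (fun n => c n / n`!%:R) (s * x) N)%:E.
pose g' N (x : measurableTypeR R) := (\sum_(0 <= n < N) (c n / n`!%:R * s ^+ n)%:E * (x ^+ n : R)%:E)%E.
have gg' N x : g N x = g' N x.
  rewrite /g /g' /pseries/= /series/= -sumEFin; apply: eq_bigr => i _.
  by rewrite -EFinM exprMn mulrA.
have ig n : mu.-integrable setT (fun x => (c n / n`!%:R * s ^+ n)%:E * (x ^+ n : R)%:E)%E.
  exact: (integrableZl measurableT (c n / n`!%:R * s ^+ n) (integrable_expn n)).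
have igN N : mu.-integrable setT (g N).
  rewrite (_ : g N = g' N); last by apply/funext.
  by apply: integrable_sum => // n _; exact: ig.
have mg N : measurable_fun setT (g N) by have /integrableP[] := igN N.
have mfs : measurable_fun [set: measurableTypeR R] (fun x => (f (s * x))%:E).
  by apply/measurable_EFinP; apply: measurableT_comp mf _; exact: measurable_scale.
have gf : {ae mu, forall x, setT x -> g^~ x @ \oo --> (f (s * x))%:E}.
  by apply: aeW => x _; apply/cvg_EFin; [exact: nearW|exact: fE].
have gb : {ae mu, forall x N, setT x -> (`|g N x| <= (expR (`|s| * `|x|))%:E)%E}.
  apply: aeW => x N _; rewrite /g abse_EFin lee_fin -normrM.
  apply: le_trans (series_exp_le N (normr_ge0 (s * x))).
  rewrite /pseries/= /series/=; apply: le_trans (ler_norm_sum _ _ _) _.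
  apply: ler_sum => i _; rewrite normrM normrX normrM normfV normr_nat mulrC ler_wpM2l ?exprn_ge0//.
  by rewrite ler_piMl// invr_ge0.
have [i1 _ i3] := dominated_convergence measurableT mg mfs gf (integrable_expR_norm `|s|) gb.
split => //; apply/esym/cvg_lim => //.
have -> : pseries (fun n => c n * moment_coef n) s = fun N => fine (\int[mu]_x g N x)%E.
  apply/funext => N; rewrite (eq_integral (g' N)); last by move=> x _; rewrite gg'.
  rewrite integral_sum//.
  have -> : (\sum_(0 <= i < N) \int[mu]_x ((c i / i`!%:R * s ^+ i)%:E * (x ^+ i)%:E) =
     \sum_(0 <= i < N) (c i * moment_coef i * s ^+ i)%:E)%E.
    apply: eq_bigr => i _; rewrite integralZl//; last exact: integrable_expn.
    rewrite -EFin_Rintegral; last exact: integrable_expn.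
    by rewrite -EFinM /moment_coef; congr (_%:E); field; rewrite pnatr_eq0 -lt0n fact_gt0.
  by rewrite sumEFin.
apply: fine_cvg; rewrite fineK; last exact: integrable_fin_num.
exact: i3.
Qed.

Let cos_c n : R := (~~ odd n)%:R * (-1) ^+ n./2.
Let sin_c n : R := (odd n)%:R * (-1) ^+ n.-1./2.

Let sign_bound (b : bool) n : `|b%:R * (-1) ^+ n : R| <= 1.
Proof. by rewrite normrM normrX normrN1 expr1n mulr1 normr_nat; case: b. Qed.

Lemma mgf_psum (s : R) : mgf s = psum moment_coef s.
Proof.
pose one (n : nat) : R := 1.
have c1 n : `|one n| <= 1 by rewrite normr1.
have mexp : measurable_fun [set: measurableTypeR R] (@expR R) by [].
have hx (x : R) : pseries (fun n => one n / n`!%:R) x @ \oo --> expR x.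
  have -> : (fun n => one n / n`!%:R) = (fun n => n`!%:R^-1) by apply/funext => n; rewrite mul1r.
  by have := @is_cvg_series_exp_coeff R x; rewrite exp_coeffE expRE.
have [_] := integral_entire_exp s c1 mexp hx.
rewrite /mgf => ->; congr psum; apply/funext => n.
by rewrite mul1r.
Qed.

Lemma integral_cos_psum (s : R) :
  mu.-integrable setT (fun x => (cos (s * x))%:E) /\
  \int[mu]_x cos (s * x) = psum (fun n => cos_c n * moment_coef n) s.
Proof.
apply: integral_entire_exp => [n||x].
- exact: sign_bound.
- by apply: continuous_measurable_fun; exact: continuous_cos.
- by have := @is_cvg_series_cos_coeff R x; rewrite cos_coeffE cosE; exact.
Qed.

Lemma integral_sin_psum (s : R) :
  mu.-integrable setT (fun x => (sin (s * x))%:E) /\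
  \int[mu]_x sin (s * x) = psum (fun n => sin_c n * moment_coef n) s.
Proof.
apply: integral_entire_exp => [n||x].
- exact: sign_bound.
- by apply: continuous_measurable_fun; exact: continuous_sin.
- by have := @is_cvg_series_sin_coeff R x; rewrite sin_coeffE sinE; exact.
Qed.

End mgf.

Section mgf_unique.
Variable R : realType.
Variables mu nu : probability (measurableTypeR R) R.
Hypotheses (fmu : finite_mgf mu) (fnu : finite_mgf nu).
Hypothesis mu_nu : forall s, mgf mu s = mgf nu s.

Lemma moment_coef_unique : moment_coef mu = moment_coef nu.
Proof.
apply: psum_inj; [exact: entire_moment_coef|exact: entire_moment_coef|].
by apply/funext => s; rewrite -!mgf_psum.
Qed.

Lemma integral_cos_unique s : \int[mu]_x cos (s * x) = \int[nu]_x cos (s * x).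
Proof.
have [_ ->] := integral_cos_psum fmu s; have [_ ->] := integral_cos_psum fnu s.
by rewrite moment_coef_unique.
Qed.

Lemma integral_sin_unique s : \int[mu]_x sin (s * x) = \int[nu]_x sin (s * x).
Proof.
have [_ ->] := integral_sin_psum fmu s; have [_ ->] := integral_sin_psum fnu s.
by rewrite moment_coef_unique.
Qed.

End mgf_unique.

(** * Integration against a measure with a density *)

Section density.
Local Open Scope ereal_scope.
Import HBNNSimple.

Lemma ge0_integral_density d (T : measurableType d) (R : realType)
    (mu nu : {measure set T -> \bar R}) (g : T -> R) (f : T -> \bar R) :
  measurable_fun setT g -> (forall x, 0 <= g x)%R ->
  (forall A, measurable A -> nu A = \int[mu]_(x in A) (g x)%:E) ->
  measurable_fun setT f -> (forall x, 0 <= f x) ->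
  \int[nu]_x f x = \int[mu]_x (f x * (g x)%:E).
Proof.
move=> mg g0 nuE mf f0.
pose h := nnsfun_approx measurableT mf.
have hf x : (EFin \o h ^~ x) @ \oo --> f x by exact: cvg_nnsfun_approx.
have hnd x : nondecreasing_seq (fun n => (h n x)%:E).
  by move=> a b ab; rewrite lee_fin; exact/lefP/nd_nnsfun_approx.
have c1 : \int[nu]_x (h n x)%:E @[n --> \oo] --> \int[nu]_x f x.
  rewrite (eq_integral (fun x => limn (fun n => (h n x)%:E))); last first.
    by move=> x _; apply/esym/cvg_lim => //; exact: hf.
  apply: cvg_monotone_convergence => //.
  - by move=> n; exact/measurable_EFinP.
  - by move=> n x _; rewrite lee_fin.
have c2 : \int[mu]_x ((h n x)%:E * (g x)%:E) @[n --> \oo] --> \int[mu]_x (f x * (g x)%:E).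
  rewrite (eq_integral (fun x => limn (fun n => (h n x)%:E * (g x)%:E))); last first.
    by move=> x _; apply/esym/cvg_lim => //; apply: cvgeZr => //; exact: hf.
  apply: cvg_monotone_convergence => //.
  - by move=> n; apply: emeasurable_funM; apply/measurable_EFinP.
  - by move=> n x _; rewrite mule_ge0// lee_fin.
  - by move=> x _ a b ab; rewrite lee_wpmul2r ?lee_fin//; exact/lefP/nd_nnsfun_approx.
suff E n : \int[nu]_x (h n x)%:E = \int[mu]_x ((h n x)%:E * (g x)%:E).
  have EE : (fun n => \int[nu]_x (h n x)%:E) = (fun n => \int[mu]_x ((h n x)%:E * (g x)%:E)).
    exact/funext.
  by rewrite EE in c1; exact: (cvg_unique _ c1 c2).
rewrite integralT_nnsfun sintegralE.
under [RHS]eq_integral => x _.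
  rewrite fimfunE -fsumEFin// ge0_mule_fsuml; last by move=> y; exact: nnfun_muleindic_ge0.
  over.
rewrite ge0_integral_fsum//; last 2 first.
- move=> y; apply: emeasurable_funM; last exact/measurable_EFinP.
  by apply/measurable_EFinP; exact: measurable_funM.
- by move=> y x _; apply: mule_ge0; [exact: nnfun_muleindic_ge0|rewrite lee_fin].
apply: eq_fsbigr => r rhn.
have r0 : (0 <= r)%R by move: rhn; rewrite inE => -[t _ <-].
under eq_integral do rewrite EFinM -muleA.
rewrite ge0_integralZl//; last 2 first.
- by apply: emeasurable_funM; apply/measurable_EFinP.
- by move=> t _; rewrite mule_ge0 ?lee_fin.
congr (_ * _); rewrite nuE//.
rewrite [LHS]integral_mkcond; apply: eq_integral => x _.
by rewrite epatch_indic muleC.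
Qed.

End density.

(** * The power series of exp (c r^2) *)

Section even_exp.
Variable R : realType.

Definition even_exp_coef (c : R) (n : nat) : R :=
  if odd n then 0 else c ^+ n./2 / (n./2)`!%:R.

Lemma pseries_even_exp (c r : R) N :
  pseries (even_exp_coef c) r N.*2 = series (exp_coeff (c * r ^+ 2)) N.
Proof.
elim: N => [|N IH]; first by rewrite /pseries/= /series/= !big_geq.
rewrite doubleS /pseries/= seriesSr seriesSr -/(pseries (even_exp_coef c) r) IH.
rewrite [RHS]seriesSr -addrA; congr (_ + _).
rewrite /even_exp_coef /exp_coeff/= odd_double/= mul0r addr0 doubleK exprMn -exprM mul2n.
by rewrite mulrAC.
Qed.

Lemma entire_even_exp c : entire (even_exp_coef c).
Proof.
apply: bounded_entire => r r1; exists (expR (`|c| * r ^+ 2)) => n.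
have r0 : 0 <= r by apply: le_trans r1.
have -> : (fun n => `|even_exp_coef c n|) = even_exp_coef `|c|.
  apply/funext => k; rewrite /even_exp_coef; case: ifP; rewrite ?normr0// => _.
  by rewrite normrM normrX normfV normr_nat.
apply: (@le_trans _ _ (pseries (even_exp_coef `|c|) r n.*2)).
  apply: nondecreasing_series; last by rewrite -addnn leq_addr.
  move=> i _ _; rewrite mulr_ge0 ?exprn_ge0// /even_exp_coef; case: ifP => // _.
rewrite pseries_even_exp; apply: series_exp_le.
by rewrite mulr_ge0// exprn_ge0.
Qed.

Lemma psum_even_exp c r : psum (even_exp_coef c) r = expR (c * r ^+ 2).
Proof.
have h1 : pseries (even_exp_coef c) r N.*2 @[N --> \oo] --> psum (even_exp_coef c) r.
  apply: (@cvg_comp _ _ _ double (pseries (even_exp_coef c) r) _ \oo).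
    move=> P [N _ HN]; exists N => //= n /= Nn; apply: HN => /=.
    by rewrite -addnn (leq_trans Nn)// leq_addr.
  by apply: cvg_psum; exact: entire_even_exp.
have E : (fun N => pseries (even_exp_coef c) r N.*2) = series (exp_coeff (c * r ^+ 2)).
  by apply/funext => N; rewrite pseries_even_exp.
rewrite E in h1; exact: (cvg_unique _ h1 (@is_cvg_series_exp_coeff _ _)).
Qed.

End even_exp.

(** * Moment generating and characteristic functions of the normal law *)

Section normal_law_mgf.
Variable R : realType.

Lemma integral_expR_normal (m s t : R) : s != 0 ->
  (\int[normal_prob m s]_x (expR (t * x))%:E = (expR (m * t + s ^+ 2 / 2 * t ^+ 2))%:E)%E.
Proof.
move=> s0.
have mE : measurable_fun [set: measurableTypeR R] (fun x : R => (expR (t * x))%:E).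
  by apply/measurable_EFinP; apply: measurableT_comp => //; exact: measurable_scale.
have E0 (x : measurableTypeR R) : (0 <= (expR (t * x))%:E)%E by rewrite lee_fin expR_ge0.
rewrite (ge0_integral_density (mu := lebesgue_measure) (measurable_normal_pdf m s)
  (normal_pdf_ge0 m s) _ mE E0)//.
(* Completing the square: the exponential tilt shifts the mean of the normal density to
   [m + s ^+ 2 * t], up to a constant factor. *)
rewrite (eq_integral (fun x : measurableTypeR R => (expR (m * t + s ^+ 2 / 2 * t ^+ 2))%:E *
   (normal_pdf (m + s ^+ 2 * t) s x)%:E)%E); last first.
  move=> x _; rewrite -!EFinM !normal_pdfE//; congr (_%:E).
  rewrite mulrCA [RHS]mulrCA; congr (_ * _); rewrite /normal_fun -!expRD; congr expR.
  by field.
rewrite ge0_integralZl//.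
- by rewrite integral_normal_pdf mule1.
- by apply/measurable_EFinP; exact: measurable_normal_pdf.
- by move=> x _; rewrite lee_fin normal_pdf_ge0.
Qed.

Lemma finite_mgf_normal (m s : R) : s != 0 -> finite_mgf (normal_prob m s).
Proof. by move=> s0 t; rewrite integral_expR_normal// ltry. Qed.

Lemma mgf_normal (m s t : R) : s != 0 ->
  mgf (normal_prob m s) t = expR (m * t + s ^+ 2 / 2 * t ^+ 2).
Proof. by move=> s0; rewrite /mgf /Rintegral integral_expR_normal. Qed.

Lemma moment_coef_std_normal : moment_coef (normal_prob 0 1) = even_exp_coef (2^-1 : R).
Proof.
have f1 := @finite_mgf_normal 0 1 (oner_neq0 R).
apply: psum_inj; [exact: entire_moment_coef|exact: entire_even_exp|].
apply/funext => s; rewrite -mgf_psum// mgf_normal// psum_even_exp.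
by rewrite mul0r add0r expr1n mul1r.
Qed.

(** The normal moments are already read off the moment generating function, as the coefficients of
    exp (t^2 / 2); the alternating signs of the cosine series change 1/2 into -1/2. *)
Lemma integral_cos_std_normal (t : R) :
  (\int[normal_prob 0 1]_x (cos (t * x))%:E = (expR (- (t ^+ 2 / 2)))%:E)%E.
Proof.
have f1 := @finite_mgf_normal 0 1 (oner_neq0 R).
have [ic ec] := integral_cos_psum f1 t.
rewrite -EFin_Rintegral// ec; congr (_%:E).
rewrite moment_coef_std_normal.
rewrite (_ : (fun n => _) = even_exp_coef (- 2^-1)); last first.
  apply/funext => n; rewrite /even_exp_coef; case: ifP => _; rewrite ?mulr0//= mul1r.
  by rewrite [(- 2^-1) ^+ _]exprNn mulrA.
by rewrite psum_even_exp; congr expR; rewrite mulNr mulrC.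
Qed.

End normal_law_mgf.

(** * Equal characteristic functions give equal laws *)

Section cf_unique.
Variable R : realType.
Implicit Types mu nu : probability (measurableTypeR R) R.

(** Equality of characteristic functions in real form: the phase [a] covers cosine and sine
    together. *)
Definition same_cf mu nu := forall s a : R,
  (\int[mu]_x (cos (s * x + a))%:E = \int[nu]_x (cos (s * x + a))%:E)%E.

Lemma mgf_unique_same_cf mu nu : finite_mgf mu -> finite_mgf nu ->
  (forall s, mgf mu s = mgf nu s) -> same_cf mu nu.
Proof.
move=> fmu fnu mn s a.
have aux (m : probability (measurableTypeR R) R) (fm : finite_mgf m) :
  (\int[m]_x (cos (s * x + a))%:E =
  (\int[m]_x cos (s * x) * cos a - \int[m]_x sin (s * x) * sin a)%:E)%E.
  have [ic _] := integral_cos_psum fm s; have [is_ _] := integral_sin_psum fm s.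
  have ic' := integrableZr measurableT (cos a) ic.
  have is' := integrableZr measurableT (sin a) is_.
  rewrite -RintegralZr// -RintegralZr// -RintegralB//.
  rewrite EFin_Rintegral; last by apply: eq_integrable (integrableB measurableT ic' is').
  by apply: eq_integral => x _; rewrite cosD.
by rewrite !aux// (integral_cos_unique fmu fnu mn) (integral_sin_unique fmu fnu mn).
Qed.

Let measurable_kernel (a x : R) :
  measurable_fun [set: measurableTypeR R * measurableTypeR R]
    (fun z => (cos (a * (z.1 - x) * z.2))%:E).
Proof.
apply/measurable_EFinP; apply: measurableT_comp.
  by apply: continuous_measurable_fun; exact: continuous_cos.
apply: measurable_funM; last exact: measurable_snd.
apply: measurable_funM => //; apply: measurable_funB => //; exact: measurable_fst.
Qed.

(** A Gaussian kernel is an average of cosines over a standard normal frequency [g], and Fubini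
    moves that average outside [mu]. *)
Let fubini_kernel mu (a x : R) :
  (\int[mu]_y (expR (- ((a * (y - x)) ^+ 2 / 2)))%:E =
   \int[normal_prob 0 1]_g \int[mu]_y (cos (a * g * y + - (a * g * x)))%:E)%E.
Proof.
under eq_integral do rewrite -integral_cos_std_normal.
rewrite (@Fubini _ _ _ _ _ mu (normal_prob 0 1) (fun z => (cos (a * (z.1 - x) * z.2))%:E)).
  apply: eq_integral => g _; apply: eq_integral => y _; congr (cos _)%:E.
  by rewrite /=; ring.
apply/integrable12ltyP; first exact: measurable_kernel.
apply: (@le_lt_trans _ _ (\int[mu]_x \int[normal_prob 0 1]_y cst 1 y)%E).
  apply: ge0_le_integral => //.
  - by move=> y _; apply: integral_ge0.
  - have mk : measurable_fun [set: measurableTypeR R * measurableTypeR R]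
        (fun z => `|(cos (a * (z.1 - x) * z.2))%:E|)%E.
      by apply: measurableT_comp => //; exact: measurable_kernel.
    exact: (measurable_fun_fubini_tonelli_F (m2 := normal_prob 0 1) _ mk).
  - move=> y _; apply: ge0_le_integral => //.
    + apply: measurableT_comp => //.
      apply: (measurableT_comp (measurable_kernel a x)); exact: pair1_measurable.
    + by move=> z _; rewrite /= lee_fin cos_max.
under eq_integral do rewrite integral_cst//= probability_setT mule1.
by rewrite integral_cst//= probability_setT mule1 ltry.
Qed.

Lemma same_cf_gauss mu nu (a x : R) : same_cf mu nu ->
  (\int[mu]_y (expR (- ((a * (y - x)) ^+ 2 / 2)))%:E =
   \int[nu]_y (expR (- ((a * (y - x)) ^+ 2 / 2)))%:E)%E.
Proof.
move=> mn; rewrite !fubini_kernel; apply: eq_integral => g _.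
exact: mn.
Qed.

Let normal_pdf_gauss (s x y : R) : s != 0 ->
  normal_pdf y s x = normal_peak s * expR (- ((s^-1 * (y - x)) ^+ 2 / 2)).
Proof.
move=> s0; rewrite normal_pdfE// /normal_fun; congr (_ * expR _).
by field.
Qed.

Let measurable_gauss_pair (s : R) : s != 0 ->
  measurable_fun [set: measurableTypeR R * measurableTypeR R]
    (fun z => normal_pdf z.1 s z.2).
Proof.
move=> s0.
under eq_fun do rewrite normal_pdf_gauss//.
apply: measurable_funM => //; apply: measurableT_comp => //.
apply: measurableT_comp => //; apply: measurable_funM => //.
apply: measurable_funX; apply: measurable_funM => //.
by apply: measurable_funB; [exact: measurable_fst|exact: measurable_snd].
Qed.

Let measurable_normal_pdf_mean (s x : R) : s != 0 ->
  measurable_fun [set: measurableTypeR R] (fun y => (normal_pdf y s x)%:E).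
Proof.
move=> s0; under eq_fun do rewrite normal_pdf_gauss//.
apply/measurable_EFinP; apply: measurable_funM => //; apply: measurableT_comp => //.
apply: measurableT_comp => //; apply: measurable_funM => //.
by apply: measurable_funX; apply: measurable_funM => //; exact: measurable_funB.
Qed.

Lemma same_cf_normal_pdf mu nu (s x : R) : s != 0 -> same_cf mu nu ->
  (\int[mu]_y (normal_pdf y s x)%:E = \int[nu]_y (normal_pdf y s x)%:E)%E.
Proof.
move=> s0 mn.
under eq_integral do rewrite normal_pdf_gauss// EFinM.
under [RHS]eq_integral do rewrite normal_pdf_gauss// EFinM.
have mg : measurable_fun [set: measurableTypeR R]
    (fun y : R => (expR (- ((s^-1 * (y - x)) ^+ 2 / 2)))%:E).
  apply/measurable_EFinP; apply: measurableT_comp => //.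
  apply: measurableT_comp => //; apply: measurable_funM => //.
  by apply: measurable_funX; apply: measurable_funM => //; exact: measurable_funB.
have p0 : (0%R <= (normal_peak s)%:E)%E by rewrite lee_fin normal_peak_ge0.
have e0 y : [set: measurableTypeR R] y -> (0 <= (expR (- ((s^-1 * (y - x)) ^+ 2 / 2)))%:E)%E.
  by move=> _; rewrite lee_fin expR_ge0.
by rewrite !ge0_integralZl// (same_cf_gauss _ _ mn).
Qed.

(** The Gaussian mollification of [f] at scale [s]. Its integral against a law depends only on the
    integrals of normal densities, as functions of their mean, against that law. *)
Definition smooth (s : R) (f : R -> R) (y : R) : \bar R :=
  (\int[lebesgue_measure]_x (f x * normal_pdf y s x)%:E)%E.

Lemma same_cf_smooth mu nu (s : R) (f : R -> R) : s != 0 ->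
  measurable_fun [set: measurableTypeR R] f -> (forall x, 0 <= f x) -> same_cf mu nu ->
  (\int[mu]_y smooth s f y = \int[nu]_y smooth s f y)%E.
Proof.
move=> s0 mf f0 mn.
have aux (m : probability (measurableTypeR R) R) :
  (\int[m]_y smooth s f y =
    \int[lebesgue_measure]_x ((f x)%:E * \int[m]_y (normal_pdf y s x)%:E))%E.
  rewrite /smooth (@fubini_tonelli _ _ _ _ _ m lebesgue_measure (fun z : measurableTypeR R * measurableTypeR R => (f z.2 * normal_pdf z.1 s z.2)%:E)).
  - apply: eq_integral => x _; under eq_integral do rewrite EFinM.
    rewrite /= ge0_integralZl//.
    + exact: measurable_normal_pdf_mean.
    + by move=> y _; rewrite lee_fin normal_pdf_ge0.
    + by rewrite lee_fin.
  - apply/measurable_EFinP; apply: measurable_funM; last exact: measurable_gauss_pair.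
    by apply: measurableT_comp mf _; exact: measurable_snd.
  - by move=> z; rewrite lee_fin mulr_ge0// normal_pdf_ge0.
by rewrite !aux; apply: eq_integral => x _; rewrite (same_cf_normal_pdf _ s0 mn).
Qed.

(** Exponentials replace the absolute value so that the smoothing error becomes a value of the
    normal moment generating function. *)
Let lip_bound (L s x y : R) : 0 <= L -> 0 < s ->
  L * `|x - y| <= L * s * (expR ((x - y) / s) + expR (- ((x - y) / s))).
Proof.
move=> L0 s0; rewrite -mulrA ler_wpM2l//.
rewrite -ler_pdivrMl// -{1}[s^-1]ger0_norm ?invr_ge0 ?(ltW s0)// -normrM [s^-1 * _]mulrC.
set u := (x - y) / s.
have h (v : R) : v <= expR v by apply: le_trans (expR_ge1Dx v); rewrite lerDr.
have [u0|u0] := leP 0 u.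
  by rewrite ger0_norm//; apply: le_trans (h u) _; rewrite lerDl expR_ge0.
by rewrite ltr0_norm//; apply: le_trans (h (- u)) _; rewrite lerDr expR_ge0.
Qed.

Let integral_lip_bound (L s y : R) : 0 <= L -> 0 < s ->
  (\int[lebesgue_measure]_x
    ((L * s * (expR ((x - y) / s) + expR (- ((x - y) / s)))) * normal_pdf y s x)%:E
   = (2 * L * s * expR (1 / 2))%:E)%E.
Proof.
move=> L0 s0; have sN0 : s != 0 by rewrite gt_eqF.
pose g (x : measurableTypeR R) := L * s * (expR ((x - y) / s) + expR (- ((x - y) / s))).
have mg : measurable_fun [set: measurableTypeR R] (fun x => (g x)%:E).
  apply/measurable_EFinP; apply: measurable_funM => //.
  have mu1 : measurable_fun [set: measurableTypeR R] (fun x => (x - y) / s).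
    by apply: measurable_funM => //; exact: measurable_funB.
  apply: measurable_funD; apply: measurableT_comp => //.
  exact: measurableT_comp.
have g0 x : (0 <= (g x)%:E)%E.
  by rewrite lee_fin mulr_ge0// ?addr_ge0 ?expR_ge0// mulr_ge0// ltW.
transitivity (\int[normal_prob y s]_x (g x)%:E)%E.
  rewrite (ge0_integral_density (mu := lebesgue_measure) (measurable_normal_pdf y s)
    (normal_pdf_ge0 y s) _ mg g0)//.
have gE x : (g x)%:E = ((L * s * expR (- y / s))%:E * (expR (s^-1 * x))%:E +
   (L * s * expR (y / s))%:E * (expR (- s^-1 * x))%:E)%E.
  rewrite -!EFinM -EFinD /g; congr (_%:E).
  rewrite -2![in RHS](mulrA (L * s)) -!expRD mulrDr; congr (_ * expR _ + _ * expR _); ring.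
under eq_integral do rewrite gE.
have Ls0 : 0 <= L * s by rewrite mulr_ge0// ltW.
have me (t : R) : measurable_fun [set: measurableTypeR R] (fun x : R => (expR (t * x))%:E).
  by apply/measurable_EFinP; apply: measurableT_comp => //; exact: measurable_scale.
have e0 (t : R) : forall x : measurableTypeR R, [set: measurableTypeR R] x -> (0 <= (expR (t * x))%:E)%E.
  by move=> x _; rewrite lee_fin expR_ge0.
have c0 (t : R) : (0%R <= (L * s * expR t)%:E)%E by rewrite lee_fin mulr_ge0// expR_ge0.
rewrite ge0_integralD//; last 4 first.
- by move=> x _; rewrite mule_ge0// e0.
- by apply: emeasurable_funM => //; exact: me.
- by move=> x _; rewrite mule_ge0// e0.
- by apply: emeasurable_funM => //; exact: me.
rewrite !ge0_integralZl//.
rewrite !integral_expR_normal// -!EFinM -EFinD; congr (_%:E).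
rewrite -2!(mulrA (L * s)) -!expRD.
have -> : - y / s + (y * s^-1 + s ^+ 2 / 2 * s^-1 ^+ 2) = 1 / 2 by field.
have -> : y / s + (y * - s^-1 + s ^+ 2 / 2 * (- s^-1) ^+ 2) = 1 / 2 by field.
by ring.
Qed.

(** The error is at most the mean of L |x - y| under the normal law around [y], which is of order
    [s]. Two inequalities with an added constant avoid subtraction in the extended reals. *)
Let smooth_close (L s y : R) (f : R -> R) : 0 <= L -> 0 < s ->
  measurable_fun [set: measurableTypeR R] f -> (forall x, 0 <= f x) ->
  (forall x z, `|f x - f z| <= L * `|x - z|) ->
  (smooth s f y <= (f y + 2 * L * s * expR (1 / 2))%:E)%E /\
  ((f y)%:E <= smooth s f y + (2 * L * s * expR (1 / 2))%:E)%E.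
Proof.
move=> L0 s0 mf f0 fL; have sN0 : s != 0 by rewrite gt_eqF.
pose g (x : measurableTypeR R) := L * s * (expR ((x - y) / s) + expR (- ((x - y) / s))).
have g0 x : 0 <= g x.
  by rewrite mulr_ge0// ?addr_ge0 ?expR_ge0// mulr_ge0// ltW.
have mg : measurable_fun [set: measurableTypeR R] g.
  apply: measurable_funM => //.
  have mu1 : measurable_fun [set: measurableTypeR R] (fun x => (x - y) / s).
    by apply: measurable_funM => //; exact: measurable_funB.
  apply: measurable_funD; apply: measurableT_comp => //.
  exact: measurableT_comp.
have fg x : `|f x - f y| <= g x by apply: le_trans (fL _ _) _; exact: lip_bound.
have p0 x := normal_pdf_ge0 y s x.
have mp := measurable_normal_pdf y s.
have add (h : R -> R) : measurable_fun [set: measurableTypeR R] h -> (forall x, 0 <= h x) ->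
    (\int[lebesgue_measure]_x ((h x + g x) * normal_pdf y s x)%:E =
    \int[lebesgue_measure]_x (h x * normal_pdf y s x)%:E + (2 * L * s * expR (1 / 2))%:E)%E.
  move=> mh h0; rewrite -(integral_lip_bound y L0 s0) -ge0_integralD//.
  - by apply: eq_integral => x _; rewrite mulrDl EFinD.
  - by move=> x _; rewrite lee_fin mulr_ge0.
  - by apply/measurable_EFinP; exact: measurable_funM.
  - by move=> x _; rewrite lee_fin mulr_ge0//; exact: g0.
  - by apply/measurable_EFinP; exact: measurable_funM.
have fyE : (\int[lebesgue_measure]_x (f y * normal_pdf y s x)%:E = (f y)%:E)%E.
  under eq_integral do rewrite EFinM.
  rewrite ge0_integralZl//.
  - by rewrite integral_normal_pdf mule1.
  - by apply/measurable_EFinP.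
  - by move=> x _; rewrite lee_fin.
  - by rewrite lee_fin.
split.
  rewrite EFinD -fyE -add//; apply: ge0_le_integral => //.
  - by move=> x _; rewrite lee_fin mulr_ge0.
  - by apply/measurable_EFinP; exact: measurable_funM.
  - by apply/measurable_EFinP; apply: measurable_funM => //; exact: measurable_funD.
  - move=> x _; rewrite lee_fin ler_wpM2r//.
    by have := fg x; rewrite ler_norml => /andP[_]; rewrite lerBlDl.
rewrite -add// -fyE; apply: ge0_le_integral => //.
- by move=> x _; rewrite lee_fin mulr_ge0.
- by apply/measurable_EFinP; exact: measurable_funM.
- by apply/measurable_EFinP; apply: measurable_funM => //; exact: measurable_funD.
- move=> x _; rewrite lee_fin ler_wpM2r//.
  by have := fg x; rewrite ler_norml => /andP[+ _]; rewrite lerNl opprB lerBlDl.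
Qed.

Let same_cf_lip_le mu nu (L : R) (f : R -> R) : 0 <= L ->
  measurable_fun [set: measurableTypeR R] f -> (forall x, 0 <= f x) ->
  (forall x z, `|f x - f z| <= L * `|x - z|) -> same_cf mu nu ->
  (\int[mu]_x (f x)%:E <= \int[nu]_x (f x)%:E)%E.
Proof.
move=> L0 mf f0 fL mn; apply/lee_addgt0Pr => e e0.
(* The smoothing error occurs twice, in total [(K - 1) * s], which [s = e / K] makes at most [e];
   the summand 1 keeps [K] positive. *)
pose K := 4 * L * expR (1 / 2) + 1.
have K0 : 0 < K by rewrite ltr_wpDl// mulr_ge0 ?expR_ge0// mulr_ge0.
pose s := e / K.
have s0 : 0 < s by rewrite divr_gt0.
have sN0 : s != 0 by rewrite gt_eqF.
pose dd := 2 * L * s * expR (1 / 2).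
have dd0 : 0 <= dd by rewrite /dd mulr_ge0 ?expR_ge0// mulr_ge0 ?(ltW s0)// mulr_ge0.
have ms : measurable_fun [set: measurableTypeR R] (smooth s f).
  have mk : measurable_fun [set: measurableTypeR R * measurableTypeR R]
      (fun z => (f z.2 * normal_pdf z.1 s z.2)%:E).
    apply/measurable_EFinP; apply: measurable_funM; last exact: measurable_gauss_pair.
    by apply: measurableT_comp mf _; exact: measurable_snd.
  apply: (measurable_fun_fubini_tonelli_F (m2 := lebesgue_measure) _ mk) => z.
  by rewrite lee_fin mulr_ge0// normal_pdf_ge0.
have sm0 y : (0 <= smooth s f y)%E.
  by apply: integral_ge0 => x _; rewrite lee_fin mulr_ge0// normal_pdf_ge0.
have mfE : measurable_fun [set: measurableTypeR R] (fun x => (f x)%:E) by apply/measurable_EFinP.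
have intc (m : probability (measurableTypeR R) R) (h : R -> \bar R) :
  measurable_fun [set: measurableTypeR R] h -> (forall x, 0 <= h x)%E ->
  (\int[m]_x (h x + dd%:E) = \int[m]_x h x + dd%:E)%E.
  move=> mh h0; rewrite ge0_integralD//.
  by rewrite integral_cst//= probability_setT mule1.
have h1 : (\int[mu]_x (f x)%:E <= \int[mu]_x smooth s f x + dd%:E)%E.
  rewrite -intc//; apply: ge0_le_integral => //.
  - by move=> x _; rewrite lee_fin.
  - by apply: emeasurable_funD.
  - by move=> x _; have [_] := smooth_close x L0 s0 mf f0 fL.
have h2 : (\int[nu]_x smooth s f x <= \int[nu]_x (f x)%:E + dd%:E)%E.
  rewrite -intc//.
  apply: ge0_le_integral => //.
  - by apply: emeasurable_funD.
  - by move=> x _; have [+ _] := smooth_close x L0 s0 mf f0 fL; rewrite EFinD.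
apply: (le_trans h1); rewrite (same_cf_smooth sN0 mf f0 mn).
apply: (@le_trans _ _ (\int[nu]_x (f x)%:E + dd%:E + dd%:E)%E).
  exact: leeD2r.
rewrite -addeA leeD2l// -EFinD lee_fin /dd.
have -> : 2 * L * s * expR (1 / 2) + 2 * L * s * expR (1 / 2) = (K - 1) * s by rewrite /K; ring.
rewrite /s mulrCA ler_piMr ?(ltW e0)// ler_pdivrMr// mul1r; lra.
Qed.

Let clamp_lip (u v : R) :
  `|Num.max 0 (Num.min 1 u) - Num.max 0 (Num.min 1 v)| <= `|u - v|.
Proof.
have spec (w : R) : let c := Num.max 0 (Num.min 1 w) in
    (w <= 0 /\ c = 0) \/ (0 <= w <= 1 /\ c = w) \/ (1 <= w /\ c = 1).
  move=> c; rewrite /c; have [w1|] := boolP (1 <= w).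
    by right; right; split => //; rewrite (min_idPl w1) (max_idPr ler01).
  rewrite -ltNge => w1; have mw := min_idPr (ltW w1).
  have [w0|] := boolP (0 <= w).
    by right; left; split; [rewrite ltW|rewrite mw (max_idPr w0)].
  by rewrite -ltNge => w0; left; split; [exact: ltW|rewrite mw (max_idPl (ltW w0))].
have h1 := ler_norm (u - v); have := ler_norm (v - u); rewrite distrC => h2.
rewrite ler_norml; move: (spec u) (spec v) => /=.
by move=> [[? ->]|[[/andP[? ?] ->]|[? ->]]] [[? ->]|[[/andP[? ?] ->]|[? ->]]];
  apply/andP; split; lra.
Qed.

(** A Lipschitz ramp equal to 1 up to [a] and to 0 from [a + n.+1%:R^-1] on lies between the
    indicators of the two half-lines; continuity from above then removes the gap. *)
Lemma same_cf_itv mu nu (a : R) : same_cf mu nu ->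
  (mu `]-oo, a]%classic <= nu `]-oo, a]%classic)%E.
Proof.
move=> mn.
have le_n (n : nat) : (mu `]-oo, a]%classic <= nu `]-oo, (a + n.+1%:R^-1)%R]%classic)%E.
  pose f (x : R) := Num.max 0 (Num.min 1 (1 - n.+1%:R * (x - a))).
  have n0 : (0 : R) < n.+1%:R by rewrite ltr0n.
  have mf : measurable_fun [set: measurableTypeR R] f.
    apply: measurable_maxr => //; apply: measurable_minr => //.
    apply: measurable_funB => //; apply: measurable_funM => //.
    exact: measurable_funB.
  have f0 x : 0 <= f x by rewrite /f le_max lexx.
  have fL x z : `|f x - f z| <= n.+1%:R * `|x - z|.
    rewrite -[X in X * _]ger0_norm// -normrM /f.
    have -> : n.+1%:R * (x - z) = (1 - n.+1%:R * (z - a)) - (1 - n.+1%:R * (x - a)) by ring.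
    by rewrite distrC; exact: clamp_lip.
  have := same_cf_lip_le (ltW n0) mf f0 fL mn.
  have mfE : measurable_fun [set: measurableTypeR R] (fun x => (f x)%:E) by apply/measurable_EFinP.
  move=> h; apply: (@le_trans _ _ (\int[mu]_x (f x)%:E)%E).
    rewrite -[X in mu X]setIT -integral_indic//; apply: ge0_le_integral => //.
    - by apply/measurable_EFinP; exact: measurable_indic.
    - move=> x _; rewrite lee_fin indicE; case: (boolP (x \in _)) => //.
      rewrite inE/= in_itv/= => xa; rewrite /f le_max; apply/orP; right.
      by rewrite le_min lexx/= lerDl oppr_ge0 mulr_ge0_le0 ?(ltW n0)// subr_le0.
  apply: (le_trans h).
  rewrite -[X in nu X]setIT -integral_indic//; apply: ge0_le_integral => //.
  - by move=> x _; rewrite lee_fin f0.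
  - by apply/measurable_EFinP; exact: measurable_indic.
  - move=> x _; rewrite lee_fin indicE; case: (boolP (x \in _)) => //.
      by move=> _; rewrite /f ge_max ler01/= ge_min lexx.
    rewrite notin_setE/= in_itv/= => /negP; rewrite -ltNge => xa.
    rewrite /f ge_max lexx/= ge_min; apply/orP; right.
    by rewrite subr_le0 -ler_pdivrMl// mulr1 lerBrDl ltW.
have cv : nu `]-oo, (a + n.+1%:R^-1)%R]%classic @[n --> \oo] --> nu `]-oo, a]%classic.
  have -> : `]-oo, a]%classic = \bigcap_n `]-oo, (a + n.+1%:R^-1)%R]%classic.
    apply/seteqP; split => x /=.
      by rewrite in_itv/= => xa n _ /=; rewrite in_itv/= (le_trans xa)// lerDl.
    move=> h; rewrite in_itv/=; apply/ler_addgt0Pr => e e0.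
    have [n ne] : exists n : nat, n.+1%:R^-1 < e.
      have := @cvg_harmonic R => /cvgrPdist_lt/(_ _ e0)[N _ /(_ N (leqnn _))].
      by rewrite sub0r normrN ger0_norm//=; exists N.
    by have := h n Logic.I; rewrite /= in_itv/= => /le_trans; apply; rewrite lerD2l ltW.
  apply: nonincreasing_cvg_mu => //.
  - by rewrite -ge0_fin_numE// fin_num_measure.
  - exact: bigcap_measurable.
  - apply/nonincreasing_seqP => n; apply/subsetPset => x /=; rewrite !in_itv/= => /le_trans; apply.
    by rewrite lerD2l lef_pV2 ?posrE ?ltr0n// ler_nat.
by rewrite -(cvg_lim _ cv)//; apply: lime_ge; [apply/cvg_ex; eexists; exact: cv|exact: nearW].
Qed.

(** Equal distribution functions give equal masses of the intervals ]a, b], which are stable under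
    intersection, generate the Borel sets and exhaust the line. *)
Lemma mgf_unique mu nu : finite_mgf mu -> finite_mgf nu ->
  (forall s, mgf mu s = mgf nu s) -> forall A, measurable A -> mu A = nu A.
Proof.
move=> fmu fnu mn.
have c1 := mgf_unique_same_cf fmu fnu mn.
have c2 := mgf_unique_same_cf fnu fmu (fun s => esym (mn s)).
have eqI a : mu `]-oo, a]%classic = nu `]-oo, a]%classic.
  by apply/eqP; rewrite eq_le !same_cf_itv.
have eqO (I : set R) : ocitv I -> mu I = nu I.
  move=> [[a b]/= _ <-].
  have [ab|ba] := leP a b; last first.
    by rewrite set_itv_ge ?measure0// bnd_simp -leNgt ltW.
  have -> : `]a, b]%classic = `]-oo, b] `\` `]-oo, a].
    by rewrite -[RHS]setCK setCD setCitvl setUC -[LHS]setCK setCitv.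
  have sub : `]-oo, a]%classic `<=` `]-oo, b]%classic.
    by move=> x /=; rewrite !in_itv/= => /le_trans; apply.
  have fin (m : probability (measurableTypeR R) R) : (m `]-oo, b]%classic < +oo)%E.
    by rewrite (le_lt_trans (probability_le1 _ _))// ltry.
  have E (m : probability (measurableTypeR R) R) : m (`]-oo, b] `\` `]-oo, a]) =
      (m `]-oo, b]%classic - m `]-oo, a]%classic)%E.
    have AB : `]-oo, b]%classic `&` `]-oo, a]%classic = `]-oo, a]%classic by exact: setIidr.
    rewrite -[in RHS]AB; apply: measureD => //.
    exact: fin.
  by rewrite !E !eqI.
move=> A mA.
apply: (@measure_unique _ R (measurableTypeR R) (@ocitv R)
  (fun n : nat => `](- n%:R)%R, n%:R]%classic) _ _ _ _ mu nu) => //.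
- exact: ocitvI.
- by move=> n; exact: is_ocitv.
- apply/seteqP; split => // x _.
  exists (Num.bound `|x|) => //=; rewrite in_itv/=.
  have := archi_boundP (normr_ge0 x); rewrite ltr_norml => /andP[h1 h2].
  by rewrite h1/= ltW.
- by move=> n; rewrite (le_lt_trans (probability_le1 _ _))// ltry.
Qed.

End cf_unique.

(** * Cramer's theorem for symmetrizations *)

Section cramer.
Variable R : realType.
Variable mu : probability (measurableTypeR R) R.
Hypothesis fmu : finite_mgf mu.

Let fmuT : fine (mu setT) = 1. Proof. by rewrite probability_setT. Qed.

(* Jensen: the tangent of [exp] at the mean *)
Lemma mgf_ge_exp_mean s : expR (s * \int[mu]_x x) <= mgf mu s.
Proof.
pose m := \int[mu]_x x.
have i1 : mu.-integrable setT (fun x => (x : R)%:E).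
  by apply: eq_integrable (integrable_expn fmu 1) => // x _; rewrite expr1.
have ic (r : R) : mu.-integrable setT (fun x : measurableTypeR R => r%:E).
  exact: finite_measure_integrable_cst.
have i2 : mu.-integrable setT (fun x : measurableTypeR R => (s * x)%:E).
  by apply: eq_integrable (integrableZl measurableT s i1).
have i3 : mu.-integrable setT (fun x : measurableTypeR R => (s * x - s * m)%:E).
  by apply: eq_integrable (integrableB measurableT i2 (ic (s * m))).
have i4 : mu.-integrable setT (fun x : measurableTypeR R => (1 + (s * x - s * m))%:E).
  by apply: eq_integrable (integrableD measurableT (ic 1) i3).
have i5 : mu.-integrable setT
    (fun x : measurableTypeR R => (expR (s * m) * (1 + (s * x - s * m)))%:E).
  by apply: eq_integrable (integrableZl measurableT (expR (s * m)) i4).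
have -> : expR (s * m) = \int[mu]_x (expR (s * m) * (1 + (s * x - s * m))).
  rewrite RintegralZl// (@RintegralD _ _ _ mu setT (fun=> 1) (fun x => s * x - s * m))//; last exact: ic.
  have -> : \int[mu]_x (s * x - s * m) = s * m - s * m.
    rewrite (@RintegralB _ _ _ mu setT (fun x => s * x) (fun=> s * m))//; last exact: ic.
    congr (_ - _); first exact: RintegralZl.
    by rewrite Rintegral_cst// fmuT mulr1.
  by rewrite Rintegral_cst// fmuT mulr1 subrr addr0 mulr1.
apply: le_Rintegral => //; first exact: integrable_expRM.
move=> x _; rewrite -[in leRHS](subrK (s * m) (s * x)) [X in _ <= expR X]addrC expRD.
by rewrite ler_wpM2l ?expR_ge0// expR_ge1Dx.
Qed.

Lemma psumN (a : R^nat) r : psum a (- r) = psum (fun n => (-1) ^+ n * a n) r.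
Proof.
rewrite /psum; congr (limn _); apply/funext => n; apply: eq_bigr => i _.
by rewrite /= [(- r) ^+ _]exprNn mulrCA mulrA.
Qed.

(* The growth of [M z = E e^(z X)] is at most Gaussian since [M (- r) >= e^(- r E X)],
   and [M (- z) e^(- c z^2)] is an entire inverse of [M]. *)
Theorem gaussian_symmetrization (c : R) : 0 < c ->
  (forall s, mgf mu s * mgf mu (- s) = expR (c * s ^+ 2)) ->
  exists m s : R, 0 < s /\ forall A, measurable A -> mu A = normal_prob m s A.
Proof.
move=> c0 hc.
pose m := \int[mu]_x x.
pose p := moment_coef mu.
have ep : entire p by exact: entire_moment_coef.
have p0 : p 0%N = 1.
  rewrite -psum0 -mgf_psum// /mgf (@eq_Rintegral _ _ _ mu setT (fun=> 1)); last first.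
    by move=> x _; rewrite mul0r expR0.
  by rewrite Rintegral_cst// fmuT mulr1.
have epN : entire (fun n => (-1) ^+ n * p n).
  by apply: (entire_le _ ep) => n; rewrite normrM normrX normrN1 expr1n mul1r.
pose q := conv (fun n => (-1) ^+ n * p n) (even_exp_coef (- c)).
have eq : entire q by apply: entire_conv => //; exact: entire_even_exp.
have pq s : psum p s * psum q s = 1.
  rewrite psum_conv//; last exact: entire_even_exp.
  rewrite -psumN psum_even_exp -!mgf_psum// mulrA hc mulNr expRN divff// expR_eq0.
  done.
have pb r : 0 <= r -> psum (fun n => `|p n|) r <= expR (1 + `|m| + (c + `|m|) * r ^+ 2).
  move=> r0; apply: le_trans (psum_norm_moment_coef_le fmu r0) _.
  have half t : `|t| = r -> mgf mu t <= expR (c * r ^+ 2 + `|m| * r).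
    move=> tr; have -> : r ^+ 2 = t ^+ 2 by rewrite -tr -normrX ger0_norm ?sqr_ge0.
    have m0 : 0 <= mgf mu t by rewrite (le_trans _ (mgf_ge_exp_mean _))// expR_ge0.
    rewrite -tr expRD -hc -mulrA ler_peMr//.
    apply: (@le_trans _ _ (expR (- t * m) * expR (`|m| * `|t|))).
      rewrite -expRD -[leLHS]expR0 ler_expR mulNr addrC subr_ge0 -normrM.
      by rewrite mulrC ler_norm.
    by rewrite ler_wpM2r ?expR_ge0// mgf_ge_exp_mean.
  (* The two signs cost a factor 2, at most e, and [r <= 1 + r ^+ 2] absorbs the linear term: hence
     the constants [1 + |m|] and [c + |m|]. *)
  apply: (@le_trans _ _ (expR (c * r ^+ 2 + `|m| * r) + expR (c * r ^+ 2 + `|m| * r))).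
    by apply: lerD; apply: half; rewrite ?normrN ger0_norm.
  rewrite -mulr2n -mulr_natl -addrA [in leRHS]expRD; apply: ler_pM => //; rewrite ?expR_ge0//.
    by apply: le_trans (expR_ge1Dx 1); lra.
  rewrite ler_expR mulrDl addrCA lerD2l -[X in _ <= X + _]mulr1 -mulrDr.
  rewrite ler_wpM2l//.
  have := sqr_ge0 (r - 1); rewrite sqrrB expr1n mulr1; lra.
have [a [b ab]] := entire_order2_exp ep eq p0 pq pb.
have bc : b = c / 2.
  have := hc 1; rewrite !mgf_psum// !ab -expRD => /expR_inj; rewrite !expr1n sqrrN expr1n; lra.
exists a, (Num.sqrt c); rewrite sqrtr_gt0; split => //.
have sc0 : Num.sqrt c != 0 by rewrite gt_eqF// sqrtr_gt0.
apply: mgf_unique => //; first exact: finite_mgf_normal.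
move=> s; rewrite mgf_normal// sqr_sqrtr ?ltW// mgf_psum// ab bc.
by [].
Qed.

End cramer.

(** * Product laws of independent pairs *)

Section independence.
Context d (T : measurableType d) (R : realType) (P : probability T R).
Local Open Scope ereal_scope.

Definition RV_pair (U V : {RV P >-> R}) : T -> R * R :=
  fun w => (U w, V w).

Lemma measurable_RV_pair U V : measurable_fun setT (RV_pair U V).
Proof. apply: (@measurable_fun_pair _ _ _ _ _ _ U V).
  exact: (measurable_funP U).
exact: (measurable_funP V). Qed.

HB.instance Definition _ U V :=
  isMeasurableFun.Build _ _ _ _ (RV_pair U V) (measurable_RV_pair U V).

(** The marginals are parameters because [eq_dist] compares laws on measurable sets only:
    [eq_dist_pair] sends two pairs to one and the same product measure. *)
Lemma independent_RV_pair (U V : {RV P >-> R}) (mu nu : probability R R) :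
  independent_RV U V ->
  (forall A, measurable A -> distribution P U A = mu A) ->
  (forall A, measurable A -> distribution P V A = nu A) ->
  forall C : set (R * R), measurable C -> P (RV_pair U V @^-1` C) = (mu \x nu) C.
Proof.
move=> UV Umu Vnu C mC; apply/esym.
transitivity (distribution P (RV_pair U V) C); last by [].
apply: (@product_measure_unique _ _ _ _ _ mu nu (distribution P (RV_pair U V))) => // A B mA mB.
transitivity (distribution P U A * distribution P V B); last first.
  by congr (_ * _); [exact: Umu|exact: Vnu].
rewrite /distribution /pushforward -UV.
- by congr (P _); apply/seteqP; split => w.
- by exists A => //; rewrite setTI.
- by exists B => //; rewrite setTI.
Qed.

(** Stated in the extended reals without integrability, since [normal_symmetrization] applies it to
    derive that the moment generating function is finite. *)
Lemma independent_RV_ge0_integral (U V : {RV P >-> R}) (f g : R -> R) :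
  independent_RV U V ->
  measurable_fun [set: R] f -> measurable_fun [set: R] g ->
  (forall x, 0 <= f x)%R -> (forall x, 0 <= g x)%R ->
  \int[P]_w (f (U w) * g (V w))%:E = \int[P]_w (f (U w))%:E * \int[P]_w (g (V w))%:E.
Proof.
move=> UV mf mg f0 g0.
pose h (z : R * R) := (f z.1 * g z.2)%:E.
have mfE : measurable_fun [set: R] (fun x => (f x)%:E) by apply/measurable_EFinP.
have mgE : measurable_fun [set: R] (fun x => (g x)%:E) by apply/measurable_EFinP.
have mh : measurable_fun setT h.
  apply/measurable_EFinP; apply: measurable_funM.
    by apply: measurableT_comp mf _; exact: measurable_fst.
  by apply: measurableT_comp mg _; exact: measurable_snd.
have h0 z : 0 <= h z by rewrite lee_fin mulr_ge0.
transitivity (\int[distribution P (RV_pair U V)]_z h z).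
  by rewrite ge0_integral_pushforward.
transitivity (\int[distribution P U \x distribution P V]_z h z).
  apply: eq_measure_integral => C mC _; exact: independent_RV_pair.
rewrite (fubini_tonelli1 _ mh h0) /fubini_F /h/=.
under eq_integral => x _.
  under eq_integral do rewrite EFinM.
  rewrite ge0_integralZl//; [|by move=> ? _; rewrite lee_fin|by rewrite lee_fin].
  over.
rewrite ge0_integralZr//; last 2 first.
- by move=> ? _; rewrite lee_fin.
- by apply: integral_ge0 => x _; rewrite lee_fin.
rewrite !ge0_integral_pushforward//.
- by move=> x; rewrite lee_fin.
- by move=> x; rewrite lee_fin.
Qed.

End independence.

(** * Sums of differences *)

Local Open Scope ereal_scope.

Section random_variables.
Context d (T : measurableType d) (R : realType) (P : probability T R).
Implicit Types U V : {RV P >-> R}.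

Lemma mfunE U : measurable_fun setT U.
Proof. exact: (measurable_funP U). Qed.

Definition sq_integrable (f : T -> R) := P.-integrable setT (fun w => (f w ^+ 2)%:E).

Lemma sq_integrableM (f g : T -> R) : measurable_fun setT f -> measurable_fun setT g ->
  sq_integrable f -> sq_integrable g -> P.-integrable setT (fun w => (f w * g w)%:E).
Proof.
move=> mf mg sf sg; apply: le_integrable (integrableD measurableT sf sg) => //.
  by apply/measurable_EFinP; exact: measurable_funM.
move=> w _; rewrite -EFinD !abse_EFin lee_fin [leRHS]ger0_norm ?addr_ge0 ?sqr_ge0//.
rewrite ler_norml; have := sqr_ge0 (f w - g w)%R; have := sqr_ge0 (f w + g w)%R.
by rewrite sqrrB sqrrD => h1 h2; have := sqr_ge0 (f w); have := sqr_ge0 (g w) => *;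
  apply/andP; split; lra.
Qed.

Lemma sq_integrable1 (f : T -> R) : measurable_fun setT f ->
  sq_integrable f -> P.-integrable setT (fun w => (f w)%:E).
Proof.
move=> mf sf.
have s1 : sq_integrable (cst 1%R).
  have ic : P.-integrable setT (EFin \o cst 1%R) by exact: finite_measure_integrable_cst.
  by apply: eq_integrable ic => // w _; rewrite /= expr1n.
have h := sq_integrableM mf (measurable_cst (1%R : R)) sf s1.
by apply: eq_integrable h => // w _; rewrite /= mulr1.
Qed.

Lemma finite_variance_sq_integrable (Y : int -> {RV P >-> R}) k :
  finite_variance Y -> sq_integrable (Y k).
Proof.
move=> fY; apply/integrableP; split.
  by apply/measurable_EFinP; apply: measurable_funX; exact: mfunE.
under eq_integral do rewrite /= ger0_norm ?sqr_ge0//.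
by have := fY k; rewrite unlock.
Qed.

Lemma finite_variance_integrable (Y : int -> {RV P >-> R}) k :
  finite_variance Y -> P.-integrable setT (fun w => (Y k w)%:E).
Proof.
move=> fY; apply: sq_integrable1; first exact: mfunE.
exact: finite_variance_sq_integrable.
Qed.

Lemma ae_eq_probability (A B : set T) : measurable A -> measurable B ->
  {ae P, forall w, A w <-> B w} -> P A = P B.
Proof.
move=> mA mB AB; rewrite -[A]setIT -[B]setIT -!integral_indic//.
apply: ae_eq_integral => //.
- by apply/measurable_EFinP; exact: measurable_indic.
- by apply/measurable_EFinP; exact: measurable_indic.
- apply: filterS AB => w ABw _; congr (_%:E).
  by rewrite !indicE; congr (nat_of_bool _)%:R; apply/idP/idP; rewrite !inE; move/ABw.
Qed.

Lemma eq_dist_ae U V : {ae P, forall w, U w = V w} -> eq_dist U V.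
Proof.
move=> UV A mA; apply: ae_eq_probability.
- by rewrite -[X in measurable X]setTI; exact: mfunE.
- by rewrite -[X in measurable X]setTI; exact: mfunE.
- by apply: filterS UV => w /= ->.
Qed.

Lemma eq_dist_integral d' (T' : measurableType d') (P' : probability T' R)
    U (V : {RV P' >-> R}) (f : R -> \bar R) : eq_dist U V ->
  measurable_fun [set: R] f -> (forall x, 0 <= f x) ->
  \int[P]_w f (U w) = \int[P']_w f (V w).
Proof.
move=> UV mf f0.
rewrite -(ge0_integral_distribution U mf f0) -(ge0_integral_distribution V mf f0).
by apply: eq_measure_integral => A mA _; exact: UV.
Qed.

Lemma eq_dist_expectation d' (T' : measurableType d') (P' : probability T' R)
    U (V : {RV P' >-> R}) : eq_dist U V -> 'E_P[U] = 'E_P'[V].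
Proof.
move=> UV; rewrite unlock.
have mE : measurable_fun [set: R] (fun x : R => x%:E) by exact/measurable_EFinP.
rewrite integralE [RHS]integralE; congr (_ - _).
  have h := eq_dist_integral UV (measurable_funepos mE) (fun x => funepos_ge0 _ x).
  by apply: etrans (etrans _ h) _; apply: eq_integral => w _; rewrite !funepos.unlock.
have h := eq_dist_integral UV (measurable_funeneg mE) (fun x => funeneg_ge0 _ x).
by apply: etrans (etrans _ h) _; apply: eq_integral => w _; rewrite !funeneg.unlock.
Qed.

Lemma partial_sumE (X : int -> {RV P >-> R}) n w :
  partial_sum X n w = (\sum_(1 <= i < n.+1) X i%:Z w)%R.
Proof.
rewrite /partial_sum; elim: n => [|n IH]; first by rewrite !big_geq.
by rewrite big_nat_recr// [RHS]big_nat_recr//= -IH.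
Qed.

Lemma centeredE U w : centered U w = (U w - fine 'E_P[U])%R.
Proof. by []. Qed.

Lemma standardizedE U w :
  standardized U w = (centered U w * (Num.sqrt (fine 'V_P[U]))^-1)%R.
Proof. by []. Qed.

Lemma variance_centered U : 'V_P[U] = \int[P]_w (centered U w ^+ 2)%:E.
Proof.
rewrite /variance covariance.unlock.
transitivity (\int[P]_w (((U \- cst (fine 'E_P[U])) * (U \- cst (fine 'E_P[U])))%R w)%:E).
  by rewrite expectation.unlock.
by apply: eq_integral => w _; rewrite centeredE expr2.
Qed.

End random_variables.

(* The library's measurable types [R] and [measurableTypeR R] have the same
   measurable sets but different displays. *)
Definition borel_RV d (T : measurableType d) (R : realType) (P : probability T R)
    (U : {RV P >-> R}) : T -> measurableTypeR R := U.

HB.instance Definition _ d (T : measurableType d) (R : realType) (P : probability T R)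
    (U : {RV P >-> R}) :=
  isMeasurableFun.Build _ _ _ _ (borel_RV U) (mfunE U).

Section equality_in_distribution.
Context d (T : measurableType d) (R : realType) (P : probability T R).
Implicit Types U V : {RV P >-> R}.

Lemma eq_dist_variance d' (T' : measurableType d') (P' : probability T' R)
    U (V : {RV P' >-> R}) : eq_dist (centered U) (centered V) -> 'V_P[U] = 'V_P'[V].
Proof.
move=> UV; rewrite !variance_centered.
apply: (eq_dist_integral (f := fun x : R => (x ^+ 2)%:E)) => //.
- by apply/measurable_EFinP; exact: measurable_funX.
- by move=> x; rewrite lee_fin sqr_ge0.
Qed.

Lemma eq_dist_standardized U V : eq_dist (centered U) (centered V) ->
  eq_dist (standardized U) (standardized V).
Proof.
move=> UV A mA; rewrite /distribution /pushforward.
pose c := (Num.sqrt (fine 'V_P[U]))^-1%R.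
have -> : standardized U @^-1` A = centered U @^-1` [set x | A (x * c)%R] by [].
have -> : standardized V @^-1` A = centered V @^-1` [set x | A (x * c)%R].
  by rewrite /c (eq_dist_variance UV).
apply: UV; rewrite -[X in measurable X]setTI.
by apply: measurable_funM.
Qed.

Lemma stationary_eq_dist (Y : int -> {RV P >-> R}) k : strictly_stationary Y ->
  eq_dist (Y k) (Y 0%R).
Proof.
move=> sY A mA; have := sY k [set x | A (x 0%R)]; rewrite /= add0r; apply.
apply: sub_sigma_algebra; exists 0%R => //; exists A => //.
by rewrite setTI.
Qed.

Lemma dependent_independent_RV (Y : int -> {RV P >-> R}) (m n : nat) :
  m_dependent m Y -> (m < n)%N -> independent_RV (Y n%:Z) (Y 0%R).
Proof.
move=> dY mn A B AY BY; rewrite setIC muleC; apply: dY.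
  by apply: sub_sigma_algebra; exists 0%R.
apply: sub_sigma_algebra; exists n%:Z => //=.
Qed.

Lemma eq_dist_pair d' (T' : measurableType d') (P' : probability T' R)
    U V (U' V' : {RV P' >-> R}) : eq_dist U U' -> eq_dist V V' ->
  independent_RV U V -> independent_RV U' V' ->
  eq_dist (((U : {mfun T >-> R}) - V)%R : {RV P >-> R})
    (((U' : {mfun T' >-> R}) - V')%R : {RV P' >-> R}).
Proof.
move=> UU VV UV UV' A mA; rewrite /distribution /pushforward.
pose C := [set z : R * R | A (z.1 - z.2)%R].
have mC : measurable C.
  rewrite -[X in measurable X]setTI.
  have mB : measurable_fun [set: R * R] (fun z : R * R => (z.1 - z.2)%R).
    by apply: measurable_funB.
  exact: mB.
transitivity (P (RV_pair U V @^-1` C)); first by [].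
transitivity (P' (RV_pair U' V' @^-1` C)); last by [].
rewrite (@independent_RV_pair _ _ _ P U V (distribution P U) (distribution P V))//.
rewrite (@independent_RV_pair _ _ _ P' U' V' (distribution P U) (distribution P V))//.
- by move=> B mB; exact/esym/UU.
- by move=> B mB; exact/esym/VV.
Qed.

End equality_in_distribution.

(** * Centered sums expressed through a given Y *)

Section given_differences.
Context d (T : measurableType d) (R : realType) (P : probability T R).
Variables (m : nat) (X Y : int -> {RV P >-> R}) (mu : R).
Hypothesis m_ge1 : (1 <= m)%N.
Hypothesis XY : differences_of m X Y mu.

Lemma partial_sum_differences n :
  {ae P, forall w, partial_sum X n w = (Y n%:Z w - Y 0 w + n%:R * mu)%R}.
Proof.
case: XY => _ _ _ XYk; elim: n => [|n IH].
  by apply: aeW => w; rewrite partial_sumE big_geq// subrr mul0r addr0.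
apply: filterS2 IH (XYk n.+1%:Z) => w e1 e2.
rewrite partial_sumE big_nat_recr//= -partial_sumE e1 e2.
have -> : (n.+1%:Z - 1)%R = n%:Z by rewrite -[n.+1]addn1 PoszD addrK.
by rewrite -natr1; ring.
Qed.

Lemma expectation_partial_sum n : 'E_P[partial_sum X n] = (n%:R * mu)%:E.
Proof.
have [sY _ fY _] := XY.
have iY k := finite_variance_integrable k fY.
rewrite unlock (ae_eq_integral (fun w => (Y n%:Z w - Y 0 w + n%:R * mu)%:E))//; last 3 first.
- by apply/measurable_EFinP; exact: mfunE.
- apply/measurable_EFinP; apply: measurable_funD => //.
  by apply: measurable_funB; exact: mfunE.
- by apply: filterS (partial_sum_differences n) => w -> _.
have iB := integrableB measurableT (iY n%:Z) (iY 0%R).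
under eq_integral do rewrite EFinD EFinB.
rewrite integralD//; last exact: finite_measure_integrable_cst.
rewrite integralB// integral_cst//= probability_setT mule1.
have := eq_dist_expectation (stationary_eq_dist n%:Z sY); rewrite unlock => ->.
rewrite subee ?add0e//.
exact: integrable_fin_num.
Qed.

Lemma centered_differences n :
  eq_dist (centered (partial_sum X n)) (((Y n%:Z : {mfun T >-> R}) - Y 0)%R : {RV P >-> R}).
Proof.
apply: eq_dist_ae; apply: filterS (partial_sum_differences n) => w.
rewrite centeredE expectation_partial_sum/= => ->.
by rewrite addrK.
Qed.

Lemma centered_eq_dist d' (T' : measurableType d') (P' : probability T' R)
    (Y0 Y0' : {RV P' >-> R}) n :
  eq_dist Y0 (Y 0) -> eq_dist Y0' (Y 0) -> independent_RV Y0 Y0' -> (m <= n)%N ->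
  eq_dist (centered (partial_sum X n)) (((Y0 : {mfun T' >-> R}) - Y0')%R : {RV P' >-> R}).
Proof.
move=> h0 h0' hi mn A mA.
have [sY dY _ _] := XY.
rewrite centered_differences//.
apply: (eq_dist_pair (U := Y n%:Z) (V := Y 0)) => //.
- by move=> B mB; rewrite h0//; exact: stationary_eq_dist.
- by move=> B mB; rewrite h0'.
- by apply: dependent_independent_RV dY _; rewrite prednK.
Qed.

Lemma centered_stable n n' : (m <= n)%N -> (m <= n')%N ->
  eq_dist (centered (partial_sum X n)) (centered (partial_sum X n')).
Proof.
move=> mn mn' A mA; rewrite !centered_differences//.
have [sY dY _ _] := XY.
apply: (eq_dist_pair (U := Y n%:Z) (V := Y 0)) => //.
- by move=> B mB; rewrite !stationary_eq_dist.
- by apply: dependent_independent_RV dY _; rewrite prednK.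
- by apply: dependent_independent_RV dY _; rewrite prednK.
Qed.

End given_differences.

(** * Limits of sequences whose law is eventually constant *)

Section convergence.
Context d (T : measurableType d) (R : realType) (P : probability T R).
Variable Z : nat -> {RV P >-> R}.
Variable m : nat.
Hypothesis Zm : forall n, (m <= n)%N -> eq_dist (Z n) (Z m).

Lemma expectation_comp_distribution (U : {RV P >-> R}) (f : R -> R) :
  continuous f -> (exists M : R, forall x, `|f x| <= M)%R ->
  'E_P[f \o U] = \int[distribution P (borel_RV U)]_x (f x)%:E.
Proof.
move=> cf [M fM]; rewrite expectation.unlock.
have mf : measurable_fun [set: measurableTypeR R] f by exact: continuous_measurable_fun.
have mfE : measurable_fun [set: measurableTypeR R] (fun x => (f x)%:E).
  exact/measurable_EFinP.
have iM : P.-integrable setT (EFin \o cst M) by exact: finite_measure_integrable_cst.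
rewrite [RHS](integral_distribution (X := borel_RV U) mfE)//.
apply: le_integrable iM => //.
- by apply/measurable_EFinP; exact: measurableT_comp mf (mfunE U).
- by move=> x _; rewrite /= lee_fin (le_trans (fM _))// ler_norm.
Qed.

Lemma cvg_in_dist_stable : cvg_in_dist Z (distribution P (borel_RV (Z m))).
Proof.
move=> f cf fb; apply: cvg_near_cst; near=> n.
rewrite !expectation_comp_distribution//; apply: eq_measure_integral => A mA _.
by apply: Zm => //; near: n; exact: nbhs_infty_ge.
Unshelve. all: by end_near. Qed.

(** Weak convergence in general does not control unbounded functions. Here the law is constant from
    [m] on, so the bounded truncations [Num.min (f x) k] have equal integrals, and monotone
    convergence removes the truncation. It is applied to exponentials. *)
Lemma cvg_in_dist_stable_integral (nu : probability (measurableTypeR R) R) (f : R -> R) :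
  cvg_in_dist Z nu -> continuous f -> (forall x, 0 <= f x)%R ->
  \int[nu]_x (f x)%:E = \int[P]_w (f (Z m w))%:E.
Proof.
move=> Znu cf f0.
have mf : measurable_fun [set: R] f by exact: continuous_measurable_fun.
pose g (k : nat) (x : R) := Num.min (f x) k%:R.
have cg k : continuous (g k).
  by move=> x; exact: (@continuous_min R R f (cst k%:R) x (cf x) (@cst_continuous _ _ _ _)).
have g0 k x : (0 <= g k x)%R by rewrite /g le_min f0/=.
have mg k : measurable_fun [set: R] (g k) by exact: continuous_measurable_fun.
have gb k : exists M : R, forall x, (`|g k x| <= M)%R.
  by exists k%:R => x; rewrite ger0_norm// /g ge_min lexx orbT.
have gE k : \int[nu]_x (g k x)%:E = \int[P]_w (g k (Z m w))%:E.
  have h1 := Znu _ (cg k) (gb k); have h2 := cvg_in_dist_stable (cg k) (gb k).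
  have := cvg_unique _ h1 h2 => -> //.
  by rewrite -expectation_comp_distribution// expectation.unlock.
have glim x : (g k x)%:E @[k --> \oo] --> (f x)%:E.
  apply/cvg_EFin; first exact: nearW.
  apply: cvg_near_cst; near=> k; rewrite /g; apply/min_idPl.
  near: k; exists (Num.bound (f x)) => // k /= kb.
  by rewrite (le_trans (ltW (archi_boundP (f0 x))))// ler_nat.
have gnd x : nondecreasing_seq (fun k => (g k x)%:E).
  by move=> a b ab; rewrite lee_fin /g le_min !ge_min lexx/= ler_nat ab orbT.
have c1 : \int[nu]_x (g k x)%:E @[k --> \oo] --> \int[nu]_x (f x)%:E.
  rewrite (eq_integral (fun x : measurableTypeR R => limn (fun k => (g k x)%:E))); last first.
    by move=> x _; apply/esym/cvg_lim => //; exact: glim.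
  apply: cvg_monotone_convergence => //.
  - by move=> k; apply/measurable_EFinP; exact: mg.
  - by move=> k x _; rewrite lee_fin.
have c2 : \int[P]_w (g k (Z m w))%:E @[k --> \oo] --> \int[P]_w (f (Z m w))%:E.
  rewrite (eq_integral (fun w => limn (fun k => (g k (Z m w))%:E))); last first.
    by move=> x _; apply/esym/cvg_lim => //; exact: glim.
  apply: cvg_monotone_convergence => //.
  - by move=> k; apply/measurable_EFinP; exact: measurableT_comp (mg k) (mfunE (Z m)).
  - by move=> k x _; rewrite lee_fin.
rewrite (_ : (fun k => \int[nu]_x (g k x)%:E) = (fun k => \int[P]_w (g k (Z m w))%:E)) in c1.
  exact: (cvg_unique _ c1 c2).
exact/funext.
Unshelve. all: by end_near. Qed.

End convergence.

(** * From a normal difference to a normal law *)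

Section normal_limit.
Context d (T : measurableType d) (R : realType) (P : probability T R).
Variables U V : {RV P >-> R}.
Hypotheses (UV : independent_RV U V) (eUV : eq_dist U V).

Lemma normal_symmetrization (k : R) :
  (exists m s : R, (0 < s)%R /\ forall t : R,
    \int[P]_w (expR (t * (k * (U w - V w))))%:E =
    (expR (m * t + s ^+ 2 / 2 * t ^+ 2))%:E) ->
  normal_law (distribution P V).
Proof.
move=> [m [s [s0 hk]]].
(* If [k = 0] the left side of [hk] is 1 for every [t]; comparing [t = 1] with [t = -1] gives
   [s = 0]. *)
have k0 : k != 0%R.
  apply/eqP => k0.
  have h t : (m * t + s ^+ 2 / 2 * t ^+ 2 = 0)%R.
    have := hk t; rewrite (_ : (fun w => _) = cst 1%:E); last first.
      by apply/funext => w; rewrite k0 mul0r mulr0 expR0.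
    rewrite integral_cst//= probability_setT mule1 => h; have e := EFin_inj h.
    by apply: expR_inj; rewrite expR0 -e.
  have h1 := h 1%R; have h2 := h (-1)%R.
  have : (s ^+ 2 = 0)%R by move: h1 h2; rewrite sqrrN expr1n; lra.
  by move/eqP; rewrite expf_eq0/= gt_eqF.
pose mu := distribution P (borel_RV V).
have mexp t : measurable_fun [set: R] (fun x : R => expR (t * x)).
  by apply: measurableT_comp => //; exact: measurable_funM.
have mexpE t : measurable_fun [set: R] (fun x : R => (expR (t * x))%:E).
  exact/measurable_EFinP.
have exp0 (t x : R) : 0 <= (expR (t * x))%:E by rewrite lee_fin expR_ge0.
have IV t : \int[mu]_x (expR (t * x))%:E = \int[P]_w (expR (t * V w))%:E.
  exact: (ge0_integral_distribution (borel_RV V) (mexpE t) (exp0 t)).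
have prod t : \int[mu]_x (expR (t * x))%:E * \int[mu]_x (expR (- t * x))%:E =
    (expR (m / k * t + s ^+ 2 / (2 * k ^+ 2) * t ^+ 2))%:E.
  have -> : (m / k * t + s ^+ 2 / (2 * k ^+ 2) * t ^+ 2 =
      m * (t / k) + s ^+ 2 / 2 * (t / k) ^+ 2)%R by field.
  rewrite -hk !IV -(eq_dist_integral eUV (mexpE t) (exp0 t)).
  rewrite -(independent_RV_ge0_integral UV (mexp t) (mexp (- t)%R))//.
  apply: eq_integral => w _; rewrite -expRD; congr (expR _)%:E.
  by rewrite mulrA divfK// mulrBr mulNr.
(* An infinite factor makes a product in [0, +oo] either infinite or 0, whereas [prod] gives a
   finite positive value. *)
have fmu : finite_mgf mu.
  move=> t; rewrite ltey; apply/eqP => it; have := prod t; rewrite it.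
  have : 0 <= \int[mu]_x (expR (- t * x))%:E by apply: integral_ge0.
  rewrite le_eqVlt => /predU1P[<-|i0]; last by rewrite gt0_mulye.
  by rewrite mule0 => -[] /esym /eqP; rewrite expR_eq0.
have mprod t : (mgf mu t * mgf mu (- t) =
    expR (m / k * t + s ^+ 2 / (2 * k ^+ 2) * t ^+ 2))%R.
  apply: EFin_inj; rewrite -prod EFinM !EFin_Rintegral//; exact: integrable_expRM.
(* The left side of [mprod] is even in [t], so the linear term in the exponent vanishes. *)
have mk0 : (m / k = 0)%R.
  have := mprod 1%R; have := mprod (-1)%R; rewrite opprK mulrC => -> /expR_inj.
  by rewrite sqrrN expr1n; lra.
have c0 : (0 < s ^+ 2 / (2 * k ^+ 2))%R.
  by rewrite divr_gt0 ?exprn_gt0// mulr_gt0// exprn_even_gt0.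
have [a [b [b0 ab]]] : exists a b : R, (0 < b)%R /\
    forall A, measurable A -> mu A = normal_prob a b A.
  by apply: (gaussian_symmetrization fmu c0) => t; rewrite mprod mk0 mul0r add0r.
by exists a, b; split => // A mA; rewrite -ab.
Qed.

End normal_limit.

(** * The limit of the standardized sums *)

Section limit_law.
Context d (T : measurableType d) (R : realType) (P : probability T R).
Variables (m : nat) (X Y : int -> {RV P >-> R}) (mu : R).
Hypothesis m_ge1 : (1 <= m)%N.
Hypothesis XY : differences_of m X Y mu.

Lemma standardized_stable n : (m <= n)%N ->
  eq_dist (standardized (partial_sum X n)) (standardized (partial_sum X m)).
Proof. by move=> mn; apply: eq_dist_standardized; exact: (centered_stable m_ge1 XY). Qed.

Lemma standardized_cvg :
  exists nu : probability (measurableTypeR R) R,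
    cvg_in_dist (fun n => standardized (partial_sum X n)) nu.
Proof.
exists (distribution P (borel_RV (standardized (partial_sum X m)))).
exact: (cvg_in_dist_stable (Z := fun n => standardized (partial_sum X n)) standardized_stable).
Qed.

Lemma normal_limit_normal (nu : probability (measurableTypeR R) R) k :
  cvg_in_dist (fun n => standardized (partial_sum X n)) nu ->
  normal_law nu -> normal_law (distribution P (Y k)).
Proof.
move=> Znu [a [s [s0 nuE]]].
have [sY dY _ _] := XY.
suff : normal_law (distribution P (Y 0)).
  move=> [b [t [t0 h]]]; exists b, t; split => // A mA.
  by rewrite (stationary_eq_dist k sY)// h.
apply: (@normal_symmetrization _ _ _ P (Y m%:Z) (Y 0) _ _
  (Num.sqrt (fine 'V_P[partial_sum X m]))^-1).
- by apply: dependent_independent_RV dY _; rewrite prednK.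
- exact: stationary_eq_dist.
exists a, s; split => // t.
rewrite -(integral_expR_normal a t (lt0r_neq0 s0)).
have ct : continuous (fun x : R => expR (t * x)).
  by move=> x; apply: continuous_comp; [exact: mulrl_continuous|exact: continuous_expR].
rewrite [RHS](eq_measure_integral nu); last by move=> A mA _; exact/esym/nuE.
rewrite (cvg_in_dist_stable_integral standardized_stable Znu ct); last first.
  by move=> x; rewrite expR_ge0.
apply: ae_eq_integral => //.
- apply/measurable_EFinP; apply: measurableT_comp => //; apply: measurable_funM => //.
  by apply: measurable_funM => //; apply: measurable_funB; exact: mfunE.
- by apply/measurable_EFinP; apply: measurableT_comp => //; apply: measurable_funM.
- apply: filterS (partial_sum_differences XY m) => w e _; congr (expR (t * _))%:E.
  rewrite standardizedE centeredE (expectation_partial_sum XY)/= e addrK.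
  by rewrite mulrC.
Qed.

End limit_law.

Local Close Scope ereal_scope.

(** * Existence of the stationary solution of X_k = Y_k - Y_(k-1) + mu *)

Section L2.
Context d (T : measurableType d) (R : realType) (P : probability T R).
Implicit Types f g h : T -> R.

Definition L2 f := measurable_fun setT f /\ sq_integrable P f.
Definition ip f g : R := \int[P]_w (f w * g w).

Lemma L2_ip_integrable f g : L2 f -> L2 g -> P.-integrable setT (fun w => (f w * g w)%:E).
Proof. by move=> [mf sf] [mg sg]; exact: sq_integrableM. Qed.

Lemma L2D f g : L2 f -> L2 g -> L2 (fun w => f w + g w).
Proof.
move=> Lf Lg; have ifg := L2_ip_integrable Lf Lg; case: Lf Lg => [mf sf] [mg sg].
split; first exact: measurable_funD.
have h1 := integrableD measurableT sf sg.
have h2 := integrableZl measurableT 2 ifg.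
have h3 := integrableD measurableT h1 h2.
apply: eq_integrable h3 => // w _ /=.
by rewrite -!EFinM -!EFinD; congr (_%:E); ring.
Qed.

Lemma L2Z (a : R) f : L2 f -> L2 (fun w => a * f w).
Proof.
move=> [mf sf]; split; first exact: measurable_funM.
have h := integrableZl measurableT (a ^+ 2) sf.
by apply: eq_integrable h => // w _ /=; rewrite -EFinM exprMn.
Qed.

Lemma L2B f g : L2 f -> L2 g -> L2 (fun w => f w - g w).
Proof.
move=> Lf Lg; have := L2D Lf (L2Z (-1) Lg).
by under eq_fun do rewrite mulN1r.
Qed.

Lemma L2_cst (a : R) : L2 (fun=> a).
Proof.
split; first exact: measurable_cst.
have ic : P.-integrable setT (EFin \o cst (a ^+ 2)) by exact: finite_measure_integrable_cst.
exact: ic.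
Qed.

Lemma L2_sum (F : nat -> T -> R) a b : (forall i, L2 (F i)) ->
  L2 (fun w => \sum_(a <= i < b) F i w).
Proof.
move=> LF; elim: b => [|b IH].
  by rewrite (_ : (fun _ => _) = fun=> 0); [exact: L2_cst|apply/funext => w; rewrite big_geq].
have [ab|ba] := leqP a b; last first.
  by rewrite (_ : (fun _ => _) = fun=> 0); [exact: L2_cst|apply/funext => w; rewrite big_geq].
rewrite (_ : (fun w => _) = fun w => \sum_(a <= i < b) F i w + F b w); first exact: L2D.
by apply/funext => w; rewrite big_nat_recr.
Qed.

Lemma ipC f g : ip f g = ip g f.
Proof. by apply: eq_Rintegral => w _; rewrite mulrC. Qed.

Lemma ipDl f g h : L2 f -> L2 g -> L2 h -> ip (fun w => f w + g w) h = ip f h + ip g h.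
Proof.
move=> Lf Lg Lh; rewrite /ip -RintegralD//; [|exact: L2_ip_integrable|exact: L2_ip_integrable].
by apply: eq_Rintegral => w _; rewrite mulrDl.
Qed.

Lemma ipZl (a : R) f h : L2 f -> L2 h -> ip (fun w => a * f w) h = a * ip f h.
Proof.
move=> Lf Lh; rewrite /ip -RintegralZl//; last exact: L2_ip_integrable.
by apply: eq_Rintegral => w _; rewrite mulrA.
Qed.

Lemma ipDr f g h : L2 f -> L2 g -> L2 h -> ip h (fun w => f w + g w) = ip h f + ip h g.
Proof. by move=> *; rewrite ipC ipDl// !(ipC h). Qed.

Lemma ipZr (a : R) f h : L2 f -> L2 h -> ip h (fun w => a * f w) = a * ip h f.
Proof. by move=> *; rewrite ipC ipZl// (ipC h). Qed.

Lemma ipBl f g h : L2 f -> L2 g -> L2 h -> ip (fun w => f w - g w) h = ip f h - ip g h.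
Proof.
move=> Lf Lg Lh; rewrite -[X in _ = _ + X]mulN1r -ipZl// -ipDl//; last exact: L2Z.
by congr ip; apply/funext => w; rewrite mulN1r.
Qed.

Lemma ipBr f g h : L2 f -> L2 g -> L2 h -> ip h (fun w => f w - g w) = ip h f - ip h g.
Proof. by move=> *; rewrite ipC ipBl// !(ipC h). Qed.

Lemma ip0l h : ip (fun=> 0) h = 0.
Proof.
rewrite /ip (_ : (fun w => 0 * h w) = fun=> 0); last by apply/funext => w; rewrite mul0r.
by rewrite Rintegral_cst// mul0r.
Qed.

Lemma ip_suml (F : nat -> T -> R) h n : (forall i, L2 (F i)) -> L2 h ->
  ip (fun w => \sum_(1 <= i < n.+1) F i w) h = \sum_(1 <= i < n.+1) ip (F i) h.
Proof.
move=> LF Lh; elim: n => [|n IH].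
  rewrite [RHS]big_geq//; rewrite -[RHS](ip0l h); congr ip; apply/funext => w.
  by rewrite big_geq.
rewrite [RHS]big_nat_recr//= -IH -ipDl//; last exact: L2_sum.
by congr ip; apply/funext => w; rewrite big_nat_recr.
Qed.

Lemma ip_sumr (F : nat -> T -> R) h n : (forall i, L2 (F i)) -> L2 h ->
  ip h (fun w => \sum_(1 <= i < n.+1) F i w) = \sum_(1 <= i < n.+1) ip h (F i).
Proof. by move=> LF Lh; rewrite ipC ip_suml//; apply: eq_bigr => i _; rewrite ipC. Qed.

Lemma EFin_ip f g : L2 f -> L2 g -> (ip f g)%:E = (\int[P]_w (f w * g w)%:E)%E.
Proof.
move=> Lf Lg; rewrite /ip /Rintegral fineK//.
by apply: integrable_fin_num => //; exact: L2_ip_integrable.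
Qed.

Definition cesaro (b : nat -> R) (N : nat) : R := (N%:R)^-1 * \sum_(1 <= i < N.+1) b i.

Lemma L2_cesaro (F : nat -> T -> R) N : (forall i, L2 (F i)) ->
  L2 (fun w => cesaro (fun i => F i w) N).
Proof. by move=> LF; apply: L2Z; exact: L2_sum. Qed.

(** Each of the [N] vectors meets itself exactly once among the [M >= N] vectors of the longer
    average, so only [M] enters the result. The families in [ip_blocks], [ip_symmetric_blocks] and
    [ip_sparse] all have such a Gram matrix. *)
Lemma ip_cesaro (F : nat -> T -> R) (a c : R) N M : (forall i, L2 (F i)) ->
  (forall i j, (0 < i)%N -> (0 < j)%N -> ip (F i) (F j) = a + (if i == j then c else 0)) ->
  (0 < N <= M)%N ->
  ip (fun w => cesaro (fun i => F i w) N) (fun w => cesaro (fun i => F i w) M) = a + c / M%:R.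
Proof.
move=> LF FF /andP[N0 NM]; have M0 : (0 < M)%N by apply: leq_trans NM.
rewrite /cesaro ipZl; [|exact: L2_sum|exact: L2_cesaro].
rewrite ipZr; [|exact: L2_sum|exact: L2_sum].
rewrite ip_suml//; last exact: L2_sum.
have -> : \sum_(1 <= i < N.+1) ip (F i) (fun w => \sum_(1 <= j < M.+1) F j w) =
    \sum_(1 <= i < N.+1) (M%:R * a + c).
  apply: eq_big_nat => i /andP[i0 iN].
  rewrite ip_sumr// (eq_big_nat _ _ (F2 := fun j => a + (if i == j then c else 0))); last first.
    by move=> j /andP[j0 _]; rewrite FF.
  rewrite big_split/= sumr_const_nat subn1/= mulr_natl; congr (_ + _).
  rewrite -big_mkcond/= (big_rem i)/=; last by rewrite mem_index_iota i0 ltnS (leq_trans _ NM).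
  rewrite eqxx big1_seq ?addr0// => j /andP[/eqP <-].
  by rewrite mem_rem_uniq ?iota_uniq// !inE eqxx.
rewrite sumr_const_nat subn1/= -mulr_natl.
by field; rewrite !pnatr_eq0 -!lt0n M0 N0.
Qed.

Lemma ip_cesaro_diff (F : nat -> T -> R) (a c : R) N M : (forall i, L2 (F i)) ->
  (forall i j, (0 < i)%N -> (0 < j)%N -> ip (F i) (F j) = a + (if i == j then c else 0)) ->
  (0 < N <= M)%N ->
  let D := fun w => cesaro (fun i => F i w) M - cesaro (fun i => F i w) N in
  ip D D = c / N%:R - c / M%:R.
Proof.
move=> LF FF NM D; have /andP[N0 NM'] := NM.
have LN := @L2_cesaro F N LF; have LM := @L2_cesaro F M LF.
rewrite /D ipBl ?ipBr//; last exact: L2B.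
rewrite [X in _ - X - _]ipC !(ip_cesaro LF FF)// ?leqnn ?N0 ?(leq_trans N0)//.
by ring.
Qed.

(* [|x| <= 2^-j + 2^j x^2], and [sum_j 2^j W_j^2] has finite expectation. *)
Lemma ae_series_cvg (W : nat -> T -> R) (c : R) : (forall j, L2 (W j)) ->
  (forall j, ip (W j) (W j) <= c / 4 ^+ j) ->
  {ae P, forall w, cvgn (series (fun j => `|W j w|))}.
Proof.
move=> LW Wc.
pose f j w := (2 ^+ j * W j w ^+ 2)%:E.
have mf j : measurable_fun setT (f j).
  by apply/measurable_EFinP; apply: measurable_funM => //; apply: measurable_funX; case: (LW j).
have f0 j w : (0 <= f j w)%E by rewrite lee_fin mulr_ge0 ?sqr_ge0// exprn_ge0.
have c0 : 0 <= c.
  have := Wc 0%N; rewrite expr0 divr1; apply: le_trans.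
  by apply: Rintegral_ge0 => w _; rewrite -expr2 sqr_ge0.
have int_f j : (\int[P]_w f j w <= (c / 2 ^+ j)%:E)%E.
  rewrite /f; under eq_integral do rewrite EFinM.
  have mW : measurable_fun setT (fun w => (W j w ^+ 2)%:E).
    by apply/measurable_EFinP; apply: measurable_funX; case: (LW j).
  rewrite ge0_integralZl//; last by move=> w _; rewrite lee_fin sqr_ge0.
  under eq_integral do rewrite expr2.
  rewrite -EFin_ip// -EFinM lee_fin.
  apply: (@le_trans _ _ (2 ^+ j * (c / 4 ^+ j))); first by rewrite ler_wpM2l// exprn_ge0.
  rewrite (_ : 4 = 2 * 2) ?exprMn; last by ring.
  by rewrite le_eqVlt; apply/orP; left; apply/eqP; field; rewrite expf_neq0.
have geo : cvgn (series (fun j => c / 2 ^+ j)).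
  rewrite (_ : (fun j => _) = geometric c 2^-1); last first.
    by apply/funext => j; rewrite /geometric/= exprVn.
  by apply: is_cvg_geometric_series; rewrite ger0_norm// invf_lt1// ltr1n.
have fin : (\int[P]_w \sum_(0 <= j <oo) f j w < +oo)%E.
  rewrite integral_nneseries//.
  apply: (@le_lt_trans _ _ (\sum_(0 <= j <oo) (c / 2 ^+ j)%:E)%E).
    by apply: lee_nneseries => // j _ _; apply: integral_ge0.
  apply: (@le_lt_trans _ _ (limn (series (fun j => c / 2 ^+ j)))%:E); last exact: ltry.
  apply: lime_le; first by apply: is_cvg_nneseries => j _ _; rewrite lee_fin divr_ge0// exprn_ge0.
  apply: nearW => n; rewrite sumEFin lee_fin.
  apply: (nondecreasing_cvgn_le (u_ := series (fun j => c / 2 ^+ j))) => //.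
  by apply: nondecreasing_series => j _ _; rewrite divr_ge0// exprn_ge0.
have ms : measurable_fun setT (fun w => \sum_(0 <= j <oo) f j w)%E.
  exact: ge0_emeasurable_sum.
have s0 w : (0 <= \sum_(0 <= j <oo) f j w)%E by apply: nneseries_ge0.
have ints : P.-integrable setT (fun w => \sum_(0 <= j <oo) f j w)%E.
  apply/integrableP; split => //.
  by under eq_integral do rewrite gee0_abs//.
apply: filterS (integrable_ae measurableT ints) => w /(_ Logic.I) sfin.
have c1 : cvgn (series (fun j => 2 ^+ j * W j w ^+ 2)).
  apply: nnseries_is_cvg; first by move=> j; rewrite mulr_ge0 ?sqr_ge0// exprn_ge0.
  by rewrite ltey; move: sfin; rewrite fin_numE => /andP[].
have geo1 : cvgn (series (fun j => (2 ^+ j)^-1 : R)).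
  rewrite (_ : (fun j => _) = geometric 1 2^-1); last first.
    by apply/funext => j; rewrite /geometric/= mul1r exprVn.
  by apply: is_cvg_geometric_series; rewrite ger0_norm// invf_lt1// ltr1n.
apply: series_le_cvg (is_cvg_seriesD geo1 c1) => j //.
- by apply: addr_ge0; [rewrite invr_ge0 exprn_ge0|rewrite mulr_ge0 ?sqr_ge0 ?exprn_ge0].
- change (`|W j w| <= (2 ^+ j)^-1 + 2 ^+ j * W j w ^+ 2).
  set x := W j w; set a : R := 2 ^+ j.
  have a0 : 0 < a by rewrite exprn_gt0.
  rewrite -[x ^+ 2]ger0_norm ?sqr_ge0// normrX /=.
  have x0 := normr_ge0 x.
  have [xa|xa] := leP `|x| a^-1.
    by rewrite (le_trans xa)// lerDl mulr_ge0 ?sqr_ge0// ltW.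
  rewrite -[leLHS]add0r lerD ?invr_ge0 ?(ltW a0)// expr2 mulrA ler_peMl//.
  by rewrite -ler_pdivrMl// mulr1 ltW.
Qed.

Lemma ae_cvg0 (W : nat -> T -> R) (c : R) : (forall j, L2 (W j)) ->
  (forall j, ip (W j) (W j) <= c / 4 ^+ j) ->
  {ae P, forall w, W j w @[j --> \oo] --> (0 : R)}.
Proof.
move=> LW Wc; apply: filterS (ae_series_cvg LW Wc) => w cw.
by apply/norm_cvg0P; exact: cvg_series_cvg_0.
Qed.

Lemma ae_cvg_incr (W : nat -> T -> R) (c : R) : (forall j, L2 (W j)) ->
  (forall j, ip (fun w => W j.+1 w - W j w) (fun w => W j.+1 w - W j w) <= c / 4 ^+ j) ->
  {ae P, forall w, cvgn (fun j => W j w)}.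
Proof.
move=> LW Wc.
have LD j : L2 (fun w => W j.+1 w - W j w) by exact: L2B.
apply: filterS (ae_series_cvg LD Wc) => w cw.
have := normed_cvg cw; rewrite /series/=.
under eq_fun do rewrite telescope_sumr//.
move=> h; have h2 : cvgn (fun j => (W j w - W 0 w) + W 0 w) by apply: is_cvgD => //; exact: is_cvg_cst.
by rewrite (_ : (fun j => W j w) = fun j => (W j w - W 0 w) + W 0 w)//; apply/funext => j; rewrite subrK.
Qed.

End L2.

(** * The solution Y as a functional of the path *)

Section potential.
Variables (R : realType) (mu : R) (L : nat).
Implicit Types (x : int -> R) (k : int).

Definition fwd x k n : R := \sum_(1 <= j < n.+1) (x (k + j%:Z) - mu).

Definition bwd x k n : R := fwd x (k - n%:Z) n.

Definition fwd_mean x k j := cesaro (fun i => fwd x k (L * i)) (4 ^ j).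

Definition bwd_mean x k j := cesaro (fun i => bwd x k (L * i)) (4 ^ j).

(** The sign comes from the block sums being Y_(k+n) - Y_k, where the terms Y_(k+n) average out. The
    upper limit, with [fine] sending infinite values to 0, is defined on every path, so
    [potential_shift] holds without exception. *)
Definition potential x k := - fine (limn_esup (fun j => (fwd_mean x k j)%:E)).

Definition bwd_potential x k := fine (limn_esup (fun j => (bwd_mean x k j)%:E)).

Lemma fwd_shift x h k n : fwd (fun l => x (l + h)) k n = fwd x (k + h) n.
Proof. by apply: eq_bigr => j _; rewrite addrAC. Qed.

Lemma potential_shift x h k : potential (fun l => x (l + h)) k = potential x (k + h).
Proof.
rewrite /potential /fwd_mean; congr (- fine (limn_esup _)); apply/funext => j.
by congr (_%:E); congr (cesaro _ _); apply/funext => i; rewrite fwd_shift.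
Qed.

Lemma fwd_recr x k n : fwd x k n.+1 = fwd x k n + (x (k + n.+1%:Z) - mu).
Proof. by rewrite /fwd big_nat_recr. Qed.

Lemma fwdD x k n p : fwd x k (n + p) = fwd x k n + fwd x (k + n%:Z) p.
Proof.
elim: p => [|p IH]; first by rewrite addn0 [X in _ + X]/fwd big_geq// addr0.
by rewrite addnS !fwd_recr IH -addrA; congr (_ + (_ + (x _ - mu))); lia.
Qed.

Lemma fwdS x k n : fwd x (k - 1) n = x k - mu + fwd x k n - (x (k + n%:Z) - mu).
Proof.
have f1 y : fwd x y 1 = x (y + 1) - mu by rewrite /fwd big_nat1.
have := fwdD x (k - 1) n 1; rewrite addn1 -add1n fwdD !f1 subrK => e.
by rewrite e [k - 1 + _]addrAC subrK addrK.
Qed.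

(** Moving a block one step to the left gains [x k] and loses the last term; the lost terms have
    indices [L] apart. *)
Lemma fwd_mean_diff x k j :
  fwd_mean x (k - 1) j - fwd_mean x k j =
  (x k - mu) - cesaro (fun i => x (k + (L * i)%:Z) - mu) (4 ^ j).
Proof.
rewrite /fwd_mean /cesaro -!mulrBr -sumrB.
under eq_bigr do rewrite fwdS addrAC addrK.
rewrite sumrB sumr_const_nat subn1/= mulrBr; congr (_ - _).
by rewrite -[X in _ * X]mulr_natl mulKf// pnatr_eq0 expn_eq0.
Qed.

Lemma potential_cvg x k : cvgn (fwd_mean x k) ->
  fwd_mean x k j @[j --> \oo] --> - potential x k.
Proof.
move=> c; rewrite /potential opprK.
have h : (fwd_mean x k j)%:E @[j --> \oo] --> (limn (fwd_mean x k))%:E.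
  by apply: cvg_EFin => //; exact: nearW.
by rewrite (cvg_limn_einf_sup h).2/=.
Qed.

Lemma bwd_potential_cvg x k l :
  bwd_mean x k j @[j --> \oo] --> l -> bwd_potential x k = l.
Proof.
move=> c; rewrite /bwd_potential.
have h : (bwd_mean x k j)%:E @[j --> \oo] --> l%:E.
  by apply: cvg_EFin => //; exact: nearW.
by rewrite (cvg_limn_einf_sup h).2.
Qed.

Lemma potential_diff x k : cvgn (fwd_mean x k) -> cvgn (fwd_mean x (k - 1)) ->
  cesaro (fun i => x (k + (L * i)%:Z) - mu) (4 ^ j) @[j --> \oo] --> (0 : R) ->
  x k = potential x k - potential x (k - 1) + mu.
Proof.
move=> c c1 c0.
have h1 : (fwd_mean x (k - 1) \- fwd_mean x k) j @[j --> \oo] -->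
    - potential x (k - 1) - - potential x k.
  by apply: cvgB; exact: potential_cvg.
have h2 : (x k - mu) - cesaro (fun i => x (k + (L * i)%:Z) - mu) (4 ^ j)
    @[j --> \oo] --> x k - mu - 0.
  by apply: cvgB => //; exact: cvg_cst.
rewrite (_ : (fun j => _) = (fwd_mean x (k - 1) \- fwd_mean x k)) in h2; last first.
  by apply/funext => j; rewrite /= fwd_mean_diff.
have e : - potential x (k - 1) - - potential x k = x k - mu - 0 by exact: (cvg_unique _ h1 h2).
by rewrite subr0 in e; rewrite -[x k in LHS](subrK mu) -e; ring.
Qed.

Lemma potential_bwd x k : cvgn (fwd_mean x k) ->
  cesaro (fun i => fwd x k (L * i) + bwd x k (L * i)) (4 ^ j) @[j --> \oo] --> (0 : R) ->
  bwd_potential x k = potential x k.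
Proof.
move=> c c0; apply: bwd_potential_cvg.
rewrite (_ : bwd_mean x k = fun j =>
    cesaro (fun i => fwd x k (L * i) + bwd x k (L * i)) (4 ^ j) - fwd_mean x k j).
  rewrite -[potential x k]opprK -[- - _]sub0r; apply: cvgB => //; exact: potential_cvg.
apply/funext => j; rewrite /= /bwd_mean /fwd_mean /cesaro -mulrBr -sumrB.
by congr (_ * _); apply: eq_bigr => i _; rewrite addrAC subrr add0r.
Qed.

Section measurability.
Context d (T : measurableType d).

Lemma measurable_cesaro (F : nat -> T -> R) N : (forall i, measurable_fun setT (F i)) ->
  measurable_fun setT (fun w => cesaro (fun i => F i w) N).
Proof. by move=> mF; apply: measurable_funM => //; exact: measurable_sum. Qed.

Lemma measurable_limsup (F : nat -> T -> R) : (forall i, measurable_fun setT (F i)) ->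
  measurable_fun setT (fun w => fine (limn_esup (fun j => (F j w)%:E))).
Proof.
move=> mF; apply: measurableT_comp => //.
by apply: (@measurable_fun_limn_esup _ _ _ _ (fun j w => (F j w)%:E)) => j; exact/measurable_EFinP.
Qed.

Lemma measurable_fwd (x : T -> int -> R) k n :
  (forall j, (0 < j <= n)%N -> measurable_fun setT (fun w => x w (k + j%:Z))) ->
  measurable_fun setT (fun w => fwd (x w) k n).
Proof.
elim: n => [|n IH] mx.
  rewrite (_ : (fun w => _) = fun=> 0)//; apply/funext => w.
  by rewrite /fwd big_geq.
under eq_fun do rewrite fwd_recr.
apply: measurable_funD; last first.
  by apply: measurable_funB => //; apply: mx; rewrite ltnSn.
by apply: IH => j /andP[j0 jn]; apply: mx; rewrite j0 ltnW.
Qed.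

(** The measurable space [T] is taken to be the probability space, the path space, and the sample
    space with the sigma-algebra of a range of coordinates; the last two uses yield stationarity and
    dependence. *)
Lemma measurable_potential (x : T -> int -> R) k :
  (forall l, k < l -> measurable_fun setT (fun w => x w l)) ->
  measurable_fun setT (fun w => potential (x w) k).
Proof.
move=> mx; rewrite /potential; apply: measurableT_comp => //; apply: measurable_limsup => j.
apply: measurable_cesaro => i; apply: measurable_fwd => l /andP[l0 _].
by apply: mx; rewrite ltrDl.
Qed.

Lemma measurable_bwd_potential (x : T -> int -> R) k :
  (forall l, l <= k -> measurable_fun setT (fun w => x w l)) ->
  measurable_fun setT (fun w => bwd_potential (x w) k).
Proof.
move=> mx; rewrite /bwd_potential; apply: measurable_limsup => j.
apply: measurable_cesaro => i; apply: measurable_fwd => l /andP[_ ln].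
by apply: mx; rewrite -addrA gerDl addrC subr_le0 lez_nat.
Qed.

End measurability.
End potential.

(** A named copy of the path space, to carry the structures from which its cylinder sigma-algebra
    becomes a measurable type. *)
Definition seqspace (R : realType) := int -> R.
HB.instance Definition _ (R : realType) := gen_eqMixin (seqspace R).
HB.instance Definition _ (R : realType) := gen_choiceMixin (seqspace R).
HB.instance Definition _ (R : realType) := isPointed.Build (seqspace R) (fun=> 0).

(** The family generating [sigma_family D f], so that the measurable sets of
    [g_sigma_algebraType (generators D f)] are those of [sigma_family D f]. *)
Definition generators (I T : Type) (d : measure_display) (T' : measurableType d)
    (D : set I) (f : I -> T -> T') : set (set T) :=
  \bigcup_(i in D) preimage_set_system setT (f i) measurable.

Lemma measurable_generators (I : Type) (T : pointedType) (d : measure_display)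
    (T' : measurableType d) (D : set I) (f : I -> T -> T') i : D i ->
  measurable_fun setT (f i : g_sigma_algebraType (generators D f) -> T').
Proof.
move=> Di _ A mA; rewrite setTI; apply: sub_sigma_algebra; exists i => //.
by exists A => //; rewrite setTI.
Qed.

Section moments.
Context d (T : measurableType d) (R : realType) (P : probability T R).

Lemma L2_le (f g : T -> R) : measurable_fun setT f -> (forall w, `|f w| <= `|g w|) ->
  L2 P g -> L2 P f.
Proof.
move=> mf fg [mg sg]; split => //; apply: le_integrable sg => //.
  by apply/measurable_EFinP; exact: measurable_funX.
by move=> w _; rewrite /= lee_fin !normrX lerXn2r ?nnegrE.
Qed.

Lemma L2_integrable (f : T -> R) : L2 P f -> P.-integrable setT (fun w => (f w)%:E).
Proof. by move=> [mf sf]; exact: sq_integrable1. Qed.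

Lemma independent_ge0_ip (U V : {RV P >-> R}) (f g : R -> R) :
  independent_RV U V ->
  measurable_fun [set: R] f -> measurable_fun [set: R] g ->
  (forall x, 0 <= f x) -> (forall x, 0 <= g x) ->
  L2 P (f \o U) -> L2 P (g \o V) ->
  ip P (f \o U) (g \o V) = (\int[P]_w f (U w)) * (\int[P]_w g (V w)).
Proof.
move=> UV mf mg f0 g0 Lf Lg; apply: EFin_inj; rewrite EFin_ip//.
rewrite (independent_RV_ge0_integral UV mf mg f0 g0) EFinM /Rintegral !fineK//.
- by apply: integrable_fin_num => //; exact: L2_integrable Lg.
- by apply: integrable_fin_num => //; exact: L2_integrable Lf.
Qed.

(** Splitting both factors into positive and negative parts reduces this to the nonnegative product
    formula. *)
Lemma independent_ip (U V : {RV P >-> R}) (c : R) :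
  independent_RV U V -> L2 P U -> L2 P V ->
  ip P (fun w => U w - c) (fun w => V w - c) =
  (\int[P]_w (U w - c)) * (\int[P]_w (V w - c)).
Proof.
move=> UV LU LV.
pose p (x : R) : R := Num.max (x - c) 0; pose q (x : R) : R := Num.max (c - x) 0.
have mp : measurable_fun [set: R] p by apply: measurable_maxr => //; exact: measurable_funB.
have mq : measurable_fun [set: R] q by apply: measurable_maxr => //; exact: measurable_funB.
have p0 x : 0 <= p x by rewrite le_max lexx orbT.
have q0 x : 0 <= q x by rewrite le_max lexx orbT.
have pq x : x - c = p x - q x.
  by rewrite /p /q; case: leP => ?; case: leP => ?; lra.
have LB (W : {RV P >-> R}) : L2 P W -> L2 P (fun w => W w - c) by move=> LW; exact: L2B LW (L2_cst _ _).
have Lp (W : {RV P >-> R}) : L2 P W -> L2 P (p \o W).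
  move=> LW; apply: L2_le (LB _ LW).
    exact: measurableT_comp mp (mfunE W).
  by move=> w /=; rewrite ger0_norm// /p ge_max ler_norm normr_ge0.
have Lq (W : {RV P >-> R}) : L2 P W -> L2 P (q \o W).
  move=> LW; apply: L2_le (LB _ LW).
    exact: measurableT_comp mq (mfunE W).
  by move=> w /=; rewrite ger0_norm// /q ge_max normr_ge0 andbT distrC ler_norm.
have E (W : {RV P >-> R}) : L2 P W ->
    \int[P]_w (W w - c) = \int[P]_w p (W w) - \int[P]_w q (W w).
  move=> LW; rewrite -RintegralB//; first by apply: eq_Rintegral => w _; exact: pq.
    exact: L2_integrable (Lp _ LW).
  exact: L2_integrable (Lq _ LW).
have -> : ip P (fun w => U w - c) (fun w => V w - c) =
    ip P (fun w => p (U w) - q (U w)) (fun w => p (V w) - q (V w)).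
  by apply: eq_Rintegral => w _; rewrite !pq.
have LpU := Lp U LU; have LpV := Lp V LV; have LqU := Lq U LU; have LqV := Lq V LV.
rewrite ipBl ?ipBr//; last exact: L2B LpV LqV.
rewrite !E// mulrBl !mulrBr.
by congr (_ - _ - (_ - _)); exact: independent_ge0_ip.
Qed.

End moments.

(** * Covariances of block sums when sigma^2 = 0 *)

Section process.
Context d (T : measurableType d) (R : realType) (P : probability T R).
Variables (m : nat) (X : int -> {RV P >-> R}).
Hypotheses (sX : strictly_stationary X) (dX : m_dependent m X).
Hypotheses (fX : finite_variance X) (s0 : asymptotic_variance m X = 0%E).

Lemma stationary_functional (f : seqspace R -> R) h (U V : {RV P >-> R}) :
  measurable_fun setT (f : g_sigma_algebraType
    (generators [set: int] (fun k (x : seqspace R) => x k)) -> R) ->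
  (forall w, U w = f (fun k => X (k + h) w)) -> (forall w, V w = f (X ^~ w)) ->
  eq_dist U V.
Proof.
move=> mf Uf Vf A mA; rewrite /distribution /pushforward.
rewrite (_ : U @^-1` A = [set w | A (f (fun k => X (k + h) w))]); last first.
  by apply/seteqP; split => w /=; rewrite Uf.
rewrite (_ : V @^-1` A = [set w | A (f (X ^~ w))]); last first.
  by apply/seteqP; split => w /=; rewrite Vf.
apply: (sX h (A := f @^-1` A)).
by have := mf measurableT A mA; rewrite setTI.
Qed.

Let mu : R := fine 'E_P[X 0].
Let xi k w : R := X k w - mu.
Let F k n w : R := fwd mu (X ^~ w) k n.

Lemma L2_X k : L2 P (X k).
Proof. by split; [exact: mfunE|exact: finite_variance_sq_integrable]. Qed.

Lemma L2_xi k : L2 P (xi k).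
Proof. exact: L2B (L2_X k) (L2_cst _ _). Qed.

Lemma L2_F k n : L2 P (F k n).
Proof. exact: (L2_sum (F := fun i => xi (k + i%:Z))) (fun i => L2_xi _). Qed.

Lemma mean_xi k : \int[P]_w xi k w = 0.
Proof.
have iX : P.-integrable setT (fun w => (X k w)%:E) by exact: L2_integrable (L2_X k).
rewrite /xi RintegralB//; last exact: finite_measure_integrable_cst.
rewrite /mu -(eq_dist_expectation (stationary_eq_dist k sX)) expectation.unlock.
by rewrite [X in _ - X]/Rintegral integral_cst//= probability_setT mule1 subrr.
Qed.

Lemma ip_xi_shift h a b : ip P (xi (a + h)) (xi (b + h)) = ip P (xi a) (xi b).
Proof.
pose U a b : {RV P >-> R} :=
  (((X a : {mfun T >-> R}) - cst mu) * ((X b : {mfun T >-> R}) - cst mu))%R.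
have UV : eq_dist (U (a + h) (b + h)) (U a b).
  apply: (@stationary_functional (fun x => (x a - mu) * (x b - mu)) h) => //.
  by apply: measurable_funM; apply: measurable_funB => //; exact: measurable_generators.
have := eq_dist_expectation UV; rewrite expectation.unlock => e.
exact: (congr1 fine e).
Qed.

Let gamma n := ip P (xi 0) (xi n%:Z).

Lemma ip_xi a b n : b = a + n%:Z -> ip P (xi a) (xi b) = gamma n.
Proof. by move=> ->; rewrite /gamma -(ip_xi_shift a 0 n%:Z) add0r [n%:Z + a]addrC. Qed.

Lemma gamma_far n : (m < n)%N -> gamma n = 0.
Proof.
move=> mn; rewrite /gamma ipC independent_ip; [|exact: dependent_independent_RV dX mn|exact: L2_X|exact: L2_X].
by have := mean_xi 0; rewrite /xi => ->; rewrite mulr0.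
Qed.

Lemma ip_F_shift h a b n p : ip P (F (a + h) n) (F (b + h) p) = ip P (F a n) (F b p).
Proof.
have E c e : ip P (F c n) (F e p) =
    \sum_(1 <= i < n.+1) \sum_(1 <= j < p.+1) ip P (xi (c + i%:Z)) (xi (e + j%:Z)).
  rewrite [LHS](ip_suml (F := fun i => xi (c + i%:Z)))//; [|by move=> i; exact: L2_xi|exact: L2_F].
  apply: eq_bigr => i _; rewrite [LHS](ip_sumr (F := fun j => xi (e + j%:Z)))//; last exact: L2_xi.
  by move=> j; exact: L2_xi.
rewrite !E; apply: eq_bigr => i _; apply: eq_bigr => j _.
by rewrite -(ip_xi_shift h (a + _)) [a + h + _]addrAC [b + h + _]addrAC.
Qed.

Let v n := ip P (F 0 n) (F 0 n).

Lemma ip_F k n : ip P (F k n) (F k n) = v n.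
Proof. by rewrite /v -(ip_F_shift k 0 0) add0r. Qed.

Lemma ip_FD k n p : v (n + p) = v n + v p + 2 * ip P (F k n) (F (k + n%:Z) p).
Proof.
have LF1 := L2_F k n; have LF2 := L2_F (k + n%:Z) p.
rewrite -(ip_F k (n + p)) -(ip_F k n) -(ip_F (k + n%:Z) p).
rewrite (_ : F k (n + p) = fun w => F k n w + F (k + n%:Z) p w); last first.
  by apply/funext => w; rewrite /F fwdD.
rewrite ipDl ?ipDr//; last exact: L2D.
by rewrite (ipC P (F (k + n%:Z) p) (F k n)); ring.
Qed.

Lemma v_recr n : v n.+1 = v n + gamma 0 + 2 * \sum_(1 <= i < n.+1) gamma i.
Proof.
have F1 k : F k 1 = xi (k + 1) by apply/funext => w; rewrite /F /fwd big_nat1.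
have v1 : v 1 = gamma 0 by rewrite /v F1 (@ip_xi _ _ 0%N)// addr0.
rewrite -[in LHS]addn1 (ip_FD 0) v1; congr (_ + 2 * _).
rewrite [LHS](ip_suml (F := fun i => xi (0 + i%:Z)))//; [|by move=> i; exact: L2_xi|exact: L2_F].
(* The [i]-th variable has covariance [gamma (n.+1 - i)] with the last one, so the order of
   summation is reversed. *)
rewrite [LHS]big_nat_rev/=; apply: eq_big_nat => i /andP[i1 ni].
by rewrite F1; apply: ip_xi; lia.
Qed.

Lemma gamma_sum : gamma 0 + 2 * \sum_(1 <= i < m.+1) gamma i = 0.
Proof.
have cov k : covariance P (X 0) (X k) = (ip P (xi 0) (xi k))%:E.
  have muk : fine 'E_P[X k] = mu by rewrite (eq_dist_expectation (stationary_eq_dist k sX)).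
  rewrite covariance.unlock EFin_ip; [|exact: L2_xi|exact: L2_xi].
  by rewrite muk -/mu expectation.unlock; apply: eq_integral.
have := s0; rewrite /asymptotic_variance /variance cov.
under eq_bigr do rewrite cov.
by rewrite sumEFin -EFinM -EFinD => -[].
Qed.

(** From [m] on, the increment in [v_recr] is sigma^2, because the covariances beyond lag [m]
    vanish. *)
Lemma v_const n : (m <= n)%N -> v n = v m.
Proof.
elim: n => [|n IH]; first by rewrite leqn0 => /eqP ->.
rewrite leq_eqVlt => /predU1P[->//|]; rewrite ltnS => mn.
rewrite v_recr (@big_cat_nat _ _ _ m.+1)//= [X in 2 * (_ + X)]big1_seq ?addr0; last first.
  by move=> i /andP[_]; rewrite mem_index_iota => /andP[mi _]; exact: gamma_far.
by rewrite -addrA gamma_sum addr0 IH.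
Qed.

(** The variance that Y_0 will have: [v m] is that of Y_m - Y_0, a difference of independent
    variables with one law. *)
Let tau := v m / 2.

Lemma tau_ge0 : 0 <= tau.
Proof. by apply: divr_ge0 => //; apply: Rintegral_ge0 => w _; rewrite -expr2 sqr_ge0. Qed.

Lemma ip_adjacent k n p : (m <= n)%N -> (m <= p)%N ->
  ip P (F k n) (F (k + n%:Z) p) = - tau.
Proof.
move=> mn mp; have mnp : (m <= n + p)%N by rewrite (leq_trans mn) ?leq_addr.
by have := ip_FD k n p; rewrite !v_const// /tau => h; lra.
Qed.

Lemma ip_nested k n p : (m <= n)%N -> (m <= p)%N ->
  ip P (F k n) (F k (n + p)) = tau.
Proof.
move=> mn mp; rewrite (_ : F k (n + p) = fun w => F k n w + F (k + n%:Z) p w); last first.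
  by apply/funext => w; rewrite /F fwdD.
rewrite ipDr; [|exact: L2_F|exact: L2_F|exact: L2_F].
by rewrite ip_adjacent// ip_F v_const// /tau; lra.
Qed.

Lemma leq_block i : (0 < i)%N -> (m <= m.+1 * i)%N.
Proof. by move=> i0; rewrite (leq_trans (leqnSn m))// leq_pmulr. Qed.

Lemma ip_sym (G : nat -> T -> R) (a c : R) :
  (forall i, (0 < i)%N -> ip P (G i) (G i) = a + c) ->
  (forall i j, (0 < i)%N -> (0 < j)%N -> ip P (G i) (G (i + j)%N) = a) ->
  forall i j, (0 < i)%N -> (0 < j)%N -> ip P (G i) (G j) = a + (if i == j then c else 0).
Proof.
move=> Gd Go i j i0 j0; case: (ltngtP i j) => [ij|ji|->]; last by rewrite Gd.
  by rewrite -(subnKC (ltnW ij)) Go ?subn_gt0// addr0.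
by rewrite ipC -(subnKC (ltnW ji)) Go ?subn_gt0// addr0.
Qed.

(** Heuristically [F k n] is Y_(k+n) - Y_k: the common end Y_k contributes [tau] to every product,
    the other ends contribute [tau] on the diagonal only. *)
Lemma ip_blocks k i j : (0 < i)%N -> (0 < j)%N ->
  ip P (F k (m.+1 * i)) (F k (m.+1 * j)) = tau + (if i == j then tau else 0).
Proof.
move: i j; apply: ip_sym => [i i0|i j i0 j0].
  by rewrite ip_F v_const ?leq_block// /tau; lra.
by rewrite mulnDr ip_nested ?leq_block.
Qed.

Let C k i w := F k (m.+1 * i) w + bwd mu (X ^~ w) k (m.+1 * i).

Lemma CE k i : C k i = F (k - (m.+1 * i)%:Z) (m.+1 * i + m.+1 * i).
Proof. by apply/funext => w; rewrite /C /F fwdD subrK addrC. Qed.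

Lemma ip_symmetric_blocks k i j : (0 < i)%N -> (0 < j)%N ->
  ip P (C k i) (C k j) = 0 + (if i == j then 2 * tau else 0).
Proof.
move: i j; apply: ip_sym => [i i0|i j i0 j0].
  rewrite CE ip_F v_const ?(leq_trans (leq_block i0)) ?leq_addr// /tau; lra.
rewrite !CE mulnDr; set n := (m.+1 * i)%N; set p := (m.+1 * j)%N.
have [mn mp] : (m <= n)%N /\ (m <= p)%N by split; exact: leq_block.
have mnn : (m <= n + n)%N by rewrite (leq_trans mn)// leq_addr.
set k1 := k - (n + p)%N%:Z; set k2 := k - n%:Z.
have e1 : k2 = k1 + p%:Z by rewrite /k1 /k2; lia.
(* The larger symmetric block is a left piece, the smaller block and a right piece; their products
   with the smaller block are [- tau], [2 * tau] and [- tau], with sum 0. *)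
rewrite (_ : F k1 _ = fun w => F k1 p w + (F k2 (n + n) w + F (k2 + (n + n)%N%:Z) p w)); last first.
  apply/funext => w; rewrite /F -fwdD e1 -fwdD; congr fwd; lia.
have LF := L2_F; rewrite ipDr//; last exact: L2D.
rewrite ipDr// ip_adjacent// ip_F v_const//.
by rewrite [X in X + _]ipC e1 ip_adjacent// /tau; lra.
Qed.

Lemma ip_sparse k i j : (0 < i)%N -> (0 < j)%N ->
  ip P (xi (k + (m.+1 * i)%N%:Z)) (xi (k + (m.+1 * j)%N%:Z)) =
  0 + (if i == j then gamma 0 else 0).
Proof.
move: i j; apply: (ip_sym (G := fun i => xi (k + (m.+1 * i)%N%:Z))) => [i i0|i j i0 j0].
  by rewrite (@ip_xi _ _ 0%N) ?addr0// add0r.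
rewrite (@ip_xi _ _ (m.+1 * j)%N); last by rewrite mulnDr PoszD addrA.
by rewrite gamma_far// leq_pmulr.
Qed.

Lemma ae_fwd_mean_cvg k : {ae P, forall w, cvgn (fwd_mean mu m.+1 (X ^~ w) k)}.
Proof.
apply: (@ae_cvg_incr _ _ _ P (fun j w => fwd_mean mu m.+1 (X ^~ w) k j) tau) => j.
  by apply: (L2_cesaro (F := fun i => F k (m.+1 * i))) => i; exact: L2_F.
rewrite (ip_cesaro_diff (F := fun i => F k (m.+1 * i)) (a := tau) (c := tau)).
- by rewrite natrX gerBl divr_ge0 ?tau_ge0.
- by move=> i; exact: L2_F.
- by move=> *; exact: ip_blocks.
- by rewrite expn_gt0 leq_pexp2l.
Qed.

Lemma ae_cesaro_cvg0 (G : nat -> T -> R) (c : R) : (forall i, L2 P (G i)) ->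
  (forall i j, (0 < i)%N -> (0 < j)%N -> ip P (G i) (G j) = 0 + (if i == j then c else 0)) ->
  {ae P, forall w, cesaro (fun i => G i w) (4 ^ j) @[j --> \oo] --> (0 : R)}.
Proof.
move=> LG ipG; apply: (@ae_cvg0 _ _ _ P (fun j w => cesaro (fun i => G i w) (4 ^ j)) c) => j.
  exact: L2_cesaro.
by rewrite (ip_cesaro LG ipG) ?expn_gt0 ?leqnn// add0r natrX.
Qed.

Lemma ae_potential_diff k : {ae P, forall w,
  X k w = potential mu m.+1 (X ^~ w) k - potential mu m.+1 (X ^~ w) (k - 1) + mu}.
Proof.
have h := ae_cesaro_cvg0 (G := fun i => xi (k + (m.+1 * i)%N%:Z)) (fun i => L2_xi _) (ip_sparse k).
by apply: filterS3 (ae_fwd_mean_cvg k) (ae_fwd_mean_cvg (k - 1)) h => w; exact: potential_diff.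
Qed.

Lemma ae_potential_bwd k : {ae P, forall w,
  bwd_potential mu m.+1 (X ^~ w) k = potential mu m.+1 (X ^~ w) k}.
Proof.
have LC i : L2 P (C k i) by rewrite CE; exact: L2_F.
have h := ae_cesaro_cvg0 LC (ip_symmetric_blocks k).
by apply: filterS2 (ae_fwd_mean_cvg k) h => w; exact: potential_bwd.
Qed.

(** Fatou's lemma along the averages, whose second moments [tau + tau / 4 ^ j] are bounded. *)
Lemma potential_finite_variance k :
  (\int[P]_w (potential mu m.+1 (X ^~ w) k ^+ 2)%:E < +oo)%E.
Proof.
pose A j w := fwd_mean mu m.+1 (X ^~ w) k j.
have LA j : L2 P (A j) by apply: (L2_cesaro (F := fun i => F k (m.+1 * i))) => i; exact: L2_F.
have EA j : (\int[P]_w (A j w ^+ 2)%:E = (tau + tau / (4 ^ j)%:R)%:E)%E.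
  under eq_integral do rewrite expr2.
  rewrite -EFin_ip//; congr (_%:E).
  rewrite (ip_cesaro (F := fun i => F k (m.+1 * i)) (a := tau) (c := tau))//.
  - by move=> i; exact: L2_F.
  - by move=> *; exact: ip_blocks.
  - by rewrite expn_gt0 leqnn.
have mA j : measurable_fun setT (fun w => (A j w ^+ 2)%:E).
  by apply/measurable_EFinP; apply: measurable_funX; case: (LA j).
have A0 j w : setT w -> (0 <= (A j w ^+ 2)%:E)%E by rewrite lee_fin sqr_ge0.
have := fatou P measurableT mA A0.
rewrite (ae_eq_integral (fun w => (potential mu m.+1 (X ^~ w) k ^+ 2)%:E))//; first last.
- apply: filterS (ae_fwd_mean_cvg k) => w /potential_cvg c _.
  have c2 : (A j w ^+ 2)%:E @[j --> \oo] --> ((potential mu m.+1 (X ^~ w) k) ^+ 2)%:E.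
    apply: cvg_EFin; first exact: nearW.
    rewrite -sqrrN; under eq_fun do rewrite expr2.
    by rewrite expr2; exact: cvgM.
  by rewrite (cvg_limn_einf_sup c2).1.
- apply/measurable_EFinP; apply: measurable_funX.
  by apply: measurable_potential => l _; exact: mfunE.
- rewrite (_ : (fun w => _) = fun w => - limn_esup (fun j => - (A j w ^+ 2)%:E))%E.
    apply: measurableT_comp => //.
    apply: (@measurable_fun_limn_esup _ _ _ _ (fun j w => - (A j w ^+ 2)%:E)%E) => j.
    exact: measurableT_comp.
  apply/funext => w; rewrite -limn_einfN; congr limn_einf; apply/funext => j /=.
  by rewrite opprK.
move=> /le_lt_trans; apply.
have c : (\int[P]_w (A j w ^+ 2)%:E)%E @[j --> \oo] --> (tau + 0)%:E.
  under eq_fun do rewrite EA.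
  apply: cvg_EFin; first exact: nearW.
  apply: cvgD; first exact: cvg_cst.
  rewrite (_ : (fun j => _) = geometric tau 4^-1); last first.
    by apply/funext => j; rewrite /geometric/= natrX exprVn.
  by apply: cvg_geometric; rewrite ger0_norm// invf_lt1// ltr1n.
by rewrite (cvg_limn_einf_sup c).1 ltry.
Qed.

End process.

(** * Stationarity and dependence of the solution *)

Section potential_process.
Context d (T : measurableType d) (R : realType) (P : probability T R).

Definition potential_fun (mu : R) (L : nat) (X : int -> {RV P >-> R}) k w :=
  potential mu L (X ^~ w) k.

Lemma measurable_potential_fun mu L X k : measurable_fun setT (potential_fun mu L X k).
Proof. by apply: measurable_potential => l _; exact: mfunE. Qed.

HB.instance Definition _ mu L X k :=
  isMeasurableFun.Build _ _ _ _ (potential_fun mu L X k) (measurable_potential_fun mu L X k).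

Definition potential_RV mu L X k : {RV P >-> R} := potential_fun mu L X k.

(** The map [psi] from paths to paths is measurable and commutes with shifts on every path, so
    stationarity of [X] can be applied to the preimage of the event. *)
Lemma potential_stationary mu L X : strictly_stationary X ->
  strictly_stationary (potential_RV mu L X).
Proof.
move=> sX h A sA.
pose cyl := generators [set: int] (fun k (x : seqspace R) => x k).
pose psi (x : seqspace R) : seqspace R := potential mu L x.
have mpsi : measurable_fun setT (psi : g_sigma_algebraType cyl -> g_sigma_algebraType cyl).
  apply: (@measurability _ _ (g_sigma_algebraType cyl) (g_sigma_algebraType cyl) setT psi cyl) => // _ [_ [k _ [B mB <-]] <-].
  rewrite !setTI; have : measurable_fun setT ((fun x => potential mu L x k) : g_sigma_algebraType cyl -> R).
    by apply: measurable_potential => l _; exact: measurable_generators.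
  by move=> /(_ measurableT B mB); rewrite setTI.
have := sX h (psi @^-1` A); rewrite /= => e.
rewrite (_ : [set w | A _] = [set w | A (psi (fun k => X (k + h) w))]); last first.
  apply/seteqP; split => w /=; rewrite (_ : psi _ = fun k => potential_RV mu L X (k + h) w)//;
    by apply/funext => k; exact: potential_shift.
by apply: e; have := mpsi measurableT A sA; rewrite setTI.
Qed.

Lemma sigma_family_sub (D : set int) (X : int -> {RV P >-> R}) :
  sigma_family D X `<=` measurable.
Proof.
apply: smallest_sub; first exact: sigma_algebra_measurable.
move=> _ [k _ [B mB <-]]; exact: mfunE.
Qed.

(** This lets almost sure agreement with an event of [G] be checked on generators only, as the next
    proof does for the past of Y. *)
Lemma sigma_algebra_ae (G : set (set T)) : sigma_algebra setT G ->
  sigma_algebra setT [set A | exists2 A', G A' & {ae P, forall w, A w <-> A' w}].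
Proof.
move=> [G0 GC GU]; split => /=.
- by exists set0 => //; exact: aeW.
- move=> A [A' GA' AA']; exists (setT `\` A'); first exact: GC.
  by apply: filterS AA' => w AA'w; split => -[_ nA]; split => // /AA'w.
- move=> F GF; have [F' F'P] := choice (fun i => let: ex_intro2 A' h h' := GF i in ex_intro _ A' (conj h h')).
  exists (\bigcup_i F' i); first by apply: GU => i; case: (F'P i).
  have : {ae P, forall w i, F i w <-> F' i w} by apply/ae_foralln => i; case: (F'P i).
  by apply: filterS => w FF'; split => -[i _ h]; exists i => //; apply/FF'.
Qed.

Lemma potential_dependent mu (m : nat) L X : (1 <= m)%N -> m_dependent m X ->
  (forall k, {ae P, forall w, bwd_potential mu L (X ^~ w) k = potential mu L (X ^~ w) k}) ->
  m_dependent m.-1 (potential_RV mu L X).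
Proof.
move=> m1 dX bX A B YA YB.
(* For [k >= m] the potential reads only coordinates [l > k], hence [l >= m.+1]: on the future side
   no null event arises. *)
have XB : sigma_family [set k : int | m.+1%:Z <= k] X B.
  apply: smallest_sub B YB; first exact: smallest_sigma_algebra.
  move=> _ [k /= mk [B mB <-]].
  set gen := generators [set k : int | m.+1%:Z <= k] X.
  have : measurable_fun setT (potential_fun mu L X k : g_sigma_algebraType gen -> R).
    apply: measurable_potential => l kl; apply: measurable_generators => /=.
    by move: mk; rewrite prednK//; lia.
  by move=> /(_ measurableT B mB).
(* On the past side the potential still looks forward, so each generator is replaced by the almost
   surely equal event defined by [bwd_potential]. *)
have [A' XA' AA'] : exists2 A', sigma_family [set k : int | k <= 0] X A' &
    {ae P, forall w, A w <-> A' w}.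
  pose G := [set A | exists2 A', sigma_family [set k : int | k <= 0] X A' &
    {ae P, forall w, A w <-> A' w}].
  suff : sigma_family [set k : int | k <= 0] (potential_RV mu L X) `<=` G by exact.
  apply: smallest_sub; first by apply: sigma_algebra_ae; exact: smallest_sigma_algebra.
  move=> _ [k /= k0 [C mC <-]].
  set gen := generators [set k : int | k <= 0] X.
  exists (setT `&` (fun w => bwd_potential mu L (X ^~ w) k) @^-1` C).
    have : measurable_fun setT ((fun w => bwd_potential mu L (X ^~ w) k) : g_sigma_algebraType gen -> R).
      apply: measurable_bwd_potential => l lk; apply: measurable_generators => /=.
      by rewrite (le_trans lk).
    by move=> /(_ measurableT C mC).
  by apply: filterS (bX k) => w e; rewrite !setTI /= e.
have mA := sigma_family_sub YA; have mA' := sigma_family_sub XA'.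
have mB := sigma_family_sub YB.
rewrite (ae_eq_probability mA mA' AA') -dX//.
apply: ae_eq_probability; [exact: measurableI|exact: measurableI|].
by apply: filterS AA' => w AA'w; split => -[/AA'w].
Qed.

Lemma differences_exist (m : nat) X : (1 <= m)%N -> strictly_stationary X ->
  m_dependent m X -> finite_variance X -> asymptotic_variance m X = 0%E ->
  exists (Y : int -> {RV P >-> R}) (mu : R), differences_of m X Y mu.
Proof.
move=> m1 sX dX fX s0.
pose mu := fine 'E_P[X 0]; exists (potential_RV mu m.+1 X), mu; split.
- exact: potential_stationary.
- by apply: potential_dependent => // k; exact: ae_potential_bwd.
- by move=> k; rewrite expectation.unlock; exact: potential_finite_variance.
- by move=> k; exact: ae_potential_diff.
Qed.

End potential_process.

Local Open Scope ereal_scope.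

Theorem corollary1p4 (R : realType) (d : measure_display)
    (T : measurableType d) (P : probability T R) (m : nat)
    (X : int -> {RV P >-> R})
    (m_ge1 : (1 <= m)%N)
    (X_stationary : strictly_stationary X)
    (X_dependent : m_dependent m X)
    (X_variance : finite_variance X)
    (sigma2_eq0 : asymptotic_variance m X = 0) :
  [/\ forall n n' : nat, (m <= n)%N -> (m <= n')%N ->
        eq_dist (centered (partial_sum X n)) (centered (partial_sum X n')),
      exists (Y : int -> {RV P >-> R}) (mu : R), differences_of m X Y mu,
      forall (Y : int -> {RV P >-> R}) (mu : R), differences_of m X Y mu ->
        forall (d' : measure_display) (T' : measurableType d')
          (P' : probability T' R) (Y0 Y0' : {RV P' >-> R}),
        eq_dist Y0 (Y 0%R) -> eq_dist Y0' (Y 0%R) -> independent_RV Y0 Y0' ->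
        forall n : nat, (m <= n)%N ->
          eq_dist (centered (partial_sum X n))
            (((Y0 : {mfun T' >-> R}) - Y0')%R : {RV P' >-> R}) &
      0 < 'V_P[X 0%R] ->
        (exists nu : probability (measurableTypeR R) R,
           cvg_in_dist (fun n => standardized (partial_sum X n)) nu) /\
        (forall nu : probability (measurableTypeR R) R,
           cvg_in_dist (fun n => standardized (partial_sum X n)) nu ->
           normal_law nu ->
           forall (Y : int -> {RV P >-> R}) (mu : R),
             differences_of m X Y mu ->
             forall k : int, normal_law (distribution P (Y k)))].
Proof.
have [Y [mu XY]] := differences_exist m_ge1 X_stationary X_dependent X_variance sigma2_eq0.
split.
- by move=> n n'; exact: centered_stable XY _ _.
- by exists Y, mu.
- by move=> Y' mu' XY' d' T' P' Y0 Y0' *; exact: (centered_eq_dist m_ge1 XY').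
- move=> _; split; first exact: standardized_cvg XY.
  by move=> nu Znu nnu Y' mu' XY' k; exact: (normal_limit_normal m_ge1 XY' k Znu nnu).
Qed.
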